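(* Let $\mathbb{X},\mathbb{Y}$ be Euclidean spaces and let $g:\mathbb{X}\to\mathbb{R}\cup\{+\infty\}$ be a closed, proper, convex function. For $A\in\mathcal{L}(\mathbb{X},\mathbb{Y})$, $b\in\mathbb{Y}$ and $\mu>0$ let $$S(A,b,\mu):=\operatorname{argmin}_{x\in\mathbb{X}}\Big\{\tfrac{1}{2\mu}\|Ax-b\|^2+g(x)\Big\}\subset\mathbb{X}.$$ Let $(\bar A,\bar b,\bar\mu)\in\mathcal{L}(\mathbb{X},\mathbb{Y})\times\mathbb{Y}\times\mathbb{R}_{++}$, suppose that $\bar x\in S(\bar A,\bar b,\bar\mu)$, set $\bar z:=\frac{1}{\bar\mu}\bar A^*(\bar b-\bar A\bar x)$, and suppose that the Fenchel conjugate $g^*$ is $\mathcal{C}^2$-cone reducible at $\bar z$. Then the following are equivalent: (i) $\ker\bar A\cap\operatorname{par}\partial g^*(\bar z)=\{0\}$. (ii) The solution mapping $S$ is single-valued and Lipschitz continuous around $(\bar A,\bar b,\bar\mu)$ with $S(\bar A,\bar b,\bar\mu)=\bar x$. (iii) The solution mapping $S(\bar A,\cdot,\cdot)$ is single-valued and Lipschitz continuous around $(\bar b,\bar\mu)$ with $S(\bar A,\bar b,\bar\mu)=\bar x$. (iv) The solution mapping $S(\bar A,\cdot,\bar\mu)$ is single-valued and Lipschitz continuous around $\bar b$ with $S(\bar A,\bar b,\bar\mu)=\bar x$. (v) The solution mapping $S$ is single-valued around $(\bar A,\bar b,\bar\mu)$ with $S(\bar A,\bar b,\bar\mu)=\bar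 x$. (vi) The solution mapping $S(\bar A,\cdot,\cdot)$ is single-valued around $(\bar b,\bar\mu)$ with $S(\bar A,\bar b,\bar\mu)=\bar x$. (vii) The solution mapping $S(\bar A,\cdot,\bar\mu)$ is single-valued around $\bar b$ with $S(\bar A,\bar b,\bar\mu)=\bar x$.
   Context: A Euclidean space is a finite-dimensional real inner product space with the induced norm $\|\cdot\|$. $\mathcal{L}(\mathbb{X},\mathbb{Y})$ is the (finite-dimensional) space of linear operators $\mathbb{X}\to\mathbb{Y}$, $A^*$ is the adjoint of $A$, $\ker A$ its kernel, and $\mathbb{R}_{++}=(0,\infty)$. A function is closed if its epigraph $\operatorname{epi} f=\{(x,\alpha)\,:\,f(x)\le\alpha\}$ is closed, and proper if $\operatorname{dom} f=\{x: f(x)<+\infty\}\neq\emptyset$ (it never takes the value $-\infty$). The Fenchel conjugate is $g^*(y)=\sup_{x\in\mathbb{X}}\{\langle y,x\rangle-g(x)\}$, and $\partial f(\bar x)=\{y: f(\bar x)+\langle y,x-\bar x\rangle\le f(x)\ \forall x\}$ is the convex subdifferential. For a nonempty convex set $\Omega$, $\operatorname{par}\Omega:=\operatorname{span}(\Omega-x)$ for any $x\in\Omega$ (the parallel subspace; independent of $x$). A set $\Theta\subset\mathbb{V}$ ($\mathbb{V}$ Euclidean) is $\mathcal{C}^2$-cone reducible at $\bar v$ if there exist a neighborhood $V$ of $\bar v$, a pointed ($C\cap(-C)=\{0\}$), closed, convex cone $C$ in some Euclidean space $\mathbb{W}$, and a $\mathcal{C}^2$-smooth mapping $h:V\to\mathbb{W}$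 such that $h(\bar v)=0$, the derivative $\mathcal{J}h(\bar v)\in\mathcal{L}(\mathbb{V},\mathbb{W})$ is surjective, and $\Theta\cap V=\{v\in V: h(v)\in C\}$. A closed, proper, convex function $f$ is $\mathcal{C}^2$-cone reducible at $\bar u\in\operatorname{dom} f$ if $\operatorname{epi} f$ is $\mathcal{C}^2$-cone reducible at $(\bar u,f(\bar u))$. A set-valued mapping is ''single-valued (and Lipschitz continuous) around'' a point if there is a neighborhood of that point on which it takes exactly one value at each point (and the resulting function is Lipschitz continuous on that neighborhood). When $S(\cdot)$ is a singleton it is identified with its element. *)

(* Defs.v *)
From HB Require Import structures.
From mathcomp Require Import all_boot all_order all_algebra.
From mathcomp Require Import all_classical all_reals.
From mathcomp Require Import ereal topology tvs normedtype convex derive.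
From mathcomp Require Import ring.

Set Implicit Arguments.
Unset Strict Implicit.
Unset Printing Implicit Defensive.

Import Order.TTheory GRing.Theory Num.Theory.
Import numFieldNormedType.Exports.

Local Open Scope classical_set_scope.
Local Open Scope ring_scope.

(* Finite-dimensional real inner product spaces. The norm, hence the topology,
   is the one induced by [inner]; [normr_inner] also makes [inner] positive
   definite. *)
HB.mixin Record NormedVector_isEuclidean (R : realType) V
    & NormedModule R V & Vector R V := {
  inner : V -> V -> R ;
  innerC : forall x y, inner x y = inner y x ;
  innerPl : forall (a : R) x y z,
    inner (a *: x + y) z = a * inner x z + inner y z ;
  normr_inner : forall x, `|x| ^+ 2 = inner x x ;
}.

#[short(type="euclideanType")]
HB.structure Definition Euclidean (R : realType) :=
  {V of NormedVector_isEuclidean R V & NormedModule R V & Vector R V}.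

Section inner_theory.
Context {R : realType} {V : euclideanType R}.
Implicit Types x y z : V.

Lemma innerDl x y z : inner (x + y) z = inner x z + inner y z.
Proof. by have := innerPl 1 x y z; rewrite scale1r mul1r. Qed.

Lemma inner0l z : inner 0 z = 0.
Proof. by apply: (addIr (inner 0 z)); rewrite -innerDl !add0r. Qed.

Lemma innerZl (a : R) x z : inner (a *: x) z = a * inner x z.
Proof. by have := innerPl a x 0 z; rewrite inner0l !addr0. Qed.

Lemma innerBl x y z : inner (x - y) z = inner x z - inner y z.
Proof. by rewrite innerDl -scaleN1r innerZl mulN1r. Qed.

Lemma innerDr x y z : inner z (x + y) = inner z x + inner z y.
Proof. by rewrite !(innerC z) innerDl. Qed.

Lemma innerZr (a : R) x z : inner z (a *: x) = a * inner z x.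
Proof. by rewrite !(innerC z) innerZl. Qed.

Lemma innerBr x y z : inner z (x - y) = inner z x - inner z y.
Proof. by rewrite !(innerC z) innerBl. Qed.

Lemma inner_eq0 x : inner x x = 0 -> x = 0.
Proof.
by rewrite -normr_inner => /eqP; rewrite expf_eq0 /= => /eqP/normr0_eq0.
Qed.

Lemma inner_CauchySchwarz x y : inner x y <= `|x| * `|y|.
Proof.
have [->|y0] := eqVneq y 0; first by rewrite innerC inner0l mulr_ge0.
have [->|x0] := eqVneq x 0; first by rewrite inner0l mulr_ge0.
have xy0 : 0 < `|x| * `|y| by rewrite mulr_gt0// normr_gt0.
have := normr_inner (`|y| *: x + (- `|x|) *: y).
rewrite innerDl !innerDr !innerZl !innerZr -!normr_inner (innerC y x) => h.
have : 0 <= 2 * (`|x| * `|y|) * (`|x| * `|y| - inner x y).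
  rewrite [leRHS](_ : _ = `| `|y| *: x + (- `|x|) *: y| ^+ 2) ?exprn_ge0//.
  by rewrite h; ring.
by rewrite pmulr_rge0 ?subr_ge0// mulr_gt0.
Qed.

(* Riesz representation *)
Lemma inner_riesz (f : 'Hom(V, R^o)) : exists v, forall x, f x = inner v x.
Proof.
pose g v : 'Hom(V, R^o) := linfun (fun x => inner v x : R^o).
have gE v x : g v x = inner v x.
  rewrite /g; pose h := GRing.isLinear.Build R V R^o _ (fun x => inner v x)
    (fun a y z => etrans (innerDr _ _ _) (congr1 (+%R^~ _) (innerZr _ _ _))).
  pose H : {linear V -> R^o} := HB.pack (fun x => inner v x : R^o) h.
  exact: (lfunE H).
have glin : linear g.
  move=> a u v; apply/lfunP => x.
  by rewrite add_lfunE scale_lfunE !gE innerPl.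
pose G : {linear V -> 'Hom(V, R^o)} := HB.pack g (GRing.isLinear.Build _ _ _ _ g glin).
have Gker : lker (linfun G) == 0%VS.
  apply/lker0P => u v; rewrite !lfunE /= => /lfunP e.
  apply/eqP; rewrite -subr_eq0; apply/eqP/inner_eq0.
  have := e (u - v); rewrite !gE => e'.
  by rewrite innerBl e' subrr.
have Glim : limg (linfun G) = fullv.
  apply/eqP; rewrite eqEdim subvf /= limg_dim_eq; last first.
    by rewrite (eqP Gker) capv0.
  by rewrite !dimvf /dim /= muln1.
have : f \in limg (linfun G) by rewrite Glim memvf.
by move=> /memv_imgP[v _ ->]; exists v => x; rewrite lfunE /= gE.
Qed.

End inner_theory.

Section operators.
Context {R : realType} {X Y : euclideanType R}.
Implicit Types A B : 'Hom(X, Y).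

Lemma hom_bounded A : exists k : R, forall x, `|A x| <= k * `|x|.
Proof.
pose e := vbasis (@fullv R X).
have co i : exists v : X, forall x, coord e i x = inner v x.
  have [v hv] := inner_riesz (linfun (coord e i : X -> R^o)).
  by exists v => x; rewrite -hv lfunE.
pose v i := projT1 (cid (co i)).
have vE i x : coord e i x = inner (v i) x := projT2 (cid (co i)) x.
exists (\sum_i `|v i| * `|A e`_i|) => x.
rewrite {1}(coord_vbasis (memvf x)) linear_sum /= mulr_suml.
apply: le_trans (ler_norm_sum _ _ _) _; apply: ler_sum => i _.
rewrite linearZ /= normrZ -/e vE mulrAC ler_wpM2r// ler_norml.
rewrite inner_CauchySchwarz andbT lerNl -mulN1r -innerZl.
by rewrite (le_trans (inner_CauchySchwarz _ _))// normrZ normrN1 mul1r.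
Qed.

Definition opnorm A : R := sup [set `|A x| | x in [set x : X | `|x| <= 1]].

Let has_sup_opnorm A :
  has_sup [set `|A x| | x in [set x : X | `|x| <= 1]].
Proof.
have [k Ak] := hom_bounded A; split.
  by exists `|A 0|, 0 => //=; rewrite normr0.
exists `|k| => _ [x /= x1 <-]; rewrite (le_trans (Ak x))//.
rewrite (le_trans (ler_norm _))// normrM normr_id.
by rewrite -[leRHS]mulr1 ler_wpM2l.
Qed.

Lemma le_opnorm A x : `|A x| <= opnorm A * `|x|.
Proof.
have [->|x0] := eqVneq x 0; first by rewrite linear0 !normr0 mulr0.
rewrite -ler_pdivrMr ?normr_gt0//; apply: sup_upper_bound => //.
exists (`|x|^-1 *: x) => /=.
  by rewrite normrZ normfV normr_id mulVf// normr_eq0.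
by rewrite linearZ /= normrZ normfV normr_id mulrC.
Qed.

Lemma opnorm_ge0 A : 0 <= opnorm A.
Proof.
apply: sup_upper_bound => //.
by exists 0; rewrite /= ?linear0 normr0.
Qed.

Lemma opnorm_le A (k : R) : 0 <= k ->
  (forall x, `|A x| <= k * `|x|) -> opnorm A <= k.
Proof.
move=> k0 Ak; apply: sup_le_ub; first by case: (has_sup_opnorm A).
move=> _ [x /= x1 <-]; rewrite (le_trans (Ak x))//.
by rewrite -[leRHS]mulr1 ler_wpM2l.
Qed.

Lemma opnormD A B : opnorm (A + B) <= opnorm A + opnorm B.
Proof.
apply: opnorm_le => [|x]; first by rewrite addr_ge0 ?opnorm_ge0.
by rewrite add_lfunE (le_trans (ler_normD _ _))// mulrDl lerD ?le_opnorm.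
Qed.

Lemma opnormZ (a : R) A : opnorm (a *: A) = `|a| * opnorm A.
Proof.
have le b B : opnorm (b *: B) <= `|b| * opnorm B.
  apply: opnorm_le => [|x]; first by rewrite mulr_ge0 ?opnorm_ge0.
  by rewrite scale_lfunE normrZ -mulrA ler_wpM2l ?le_opnorm.
apply/eqP; rewrite eq_le le /=.
have [->|a0] := eqVneq a 0; first by rewrite normr0 mul0r opnorm_ge0.
rewrite -ler_pdivlMl ?normr_gt0// -normfV.
by rewrite -[leLHS]/(opnorm A) -{1}[A](scalerK a0) le.
Qed.

Lemma opnorm0_eq0 A : opnorm A = 0 -> A = 0.
Proof.
move=> A0; apply/lfunP => x; rewrite zero_lfunE; apply/normr0_eq0/le_anti.
by rewrite normr_ge0 andbT (le_trans (le_opnorm _ _))// A0 mul0r.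
Qed.

Definition adjoint A : 'Hom(Y, X) :=
  xget 0 [set B : 'Hom(Y, X) | forall x y, inner (A x) y = inner x (B y)].

Lemma adjointE A x y : inner (A x) y = inner x (adjoint A y).
Proof.
suff : [set B : 'Hom(Y, X) | forall x y, inner (A x) y = inner x (B y)] !=set0.
  by rewrite /adjoint => -[B hB]; case: xgetP => [_ -> ->//|/(_ B)].
pose f y : 'Hom(X, R^o) := (linfun (fun x => inner (A x) y : R^o)).
have fE y' x' : f y' x' = inner (A x') y'.
  have h : linear (fun x => inner (A x) y' : R^o).
    by move=> a u v; rewrite linearP innerPl.
  pose H : {linear X -> R^o} :=
    HB.pack (fun x => inner (A x) y' : R^o) (GRing.isLinear.Build _ _ _ _ _ h).
  exact: (lfunE H).
have [b hb] := choice (fun y => inner_riesz (f y)).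
have bE x' y' : inner (A x') y' = inner x' (b y') by rewrite innerC innerC -fE hb innerC.
have blin : linear b.
  move=> a u v; apply/eqP; rewrite -subr_eq0; apply/eqP/inner_eq0.
  set w := _ - _; rewrite {2}/w innerBr -bE.
  by rewrite !innerDr !innerZr !bE subrr.
pose G : {linear Y -> X} := HB.pack b (GRing.isLinear.Build _ _ _ _ b blin).
by exists (linfun G) => x' y'; rewrite lfunE /= bE.
Qed.

End operators.

(* L(X, Y) carries the operator norm. *)
HB.instance Definition _ (R : realType) (X Y : euclideanType R) :=
  Lmodule_isNormed.Build R 'Hom(X, Y) (@opnormD R X Y) (@opnormZ R X Y)
    (@opnorm0_eq0 R X Y).

Section convex_analysis.
Context {R : realType} {X : euclideanType R}.
Implicit Types (f g : X -> \bar R) (x y : X) (D : set X).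

Definition dom f : set X := [set x | (f x < +oo)%E].

Definition epi f : set (X * R) := [set p | (f p.1 <= p.2%:E)%E].

Definition closed_fun f := closed (epi f).

Definition proper_fun f := dom f !=set0 /\ forall x, (-oo < f x)%E.

Definition convex_fun f := convex_set (epi f).

Definition fenchel_conj g : X -> \bar R :=
  fun y => ereal_sup [set ((inner y x)%:E - g x)%E | x in [set: X]].

Definition subdifferential f x0 : set X :=
  [set y | forall x, (f x0 + (inner y (x - x0))%:E <= f x)%E].

(* [<<s>>] spans a finite sequence only; a set may be infinite. *)
Definition set_span D : set X :=
  [set v | exists2 s : seq X, {in s, forall u, D u} & v \in <<s>>%VS].

(* The parallel subspace of a nonempty convex set; the span does not depend on
   the base point [x]. *)
Definition par D : set X :=
  [set v | exists2 x, D x & set_span [set y - x | y in D] v].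

End convex_analysis.

Section cone_reducibility.
Context {R : realType}.

(* C^2 on an open set [O]. Second-order smoothness is stated on the maps
   [y |-> Dh(y) u], [u] fixed: as [V] is finite-dimensional wherever this is
   used, this is the same as [y |-> Dh(y)] being C^1 into the operators. *)
Definition C2_on {V W : normedModType R} (O : set V) (h : V -> W) :=
  forall x, O x ->
    [/\ differentiable h x,
        forall u, differentiable (fun y => 'd h y u) x &
        forall u v, {for x, continuous
          (fun y => 'd (fun z => 'd h z u) y v)}].

Definition pointed_closed_convex_cone {W : euclideanType R} (C : set W) :=
  [/\ closed C, convex_set C,
      forall (t : R) w, 0 <= t -> C w -> C (t *: w) &
      C `&` [set - w | w in C] = [set 0]].

(* Only the topology and the linear structure of [V] matter here, so that [V]
   may be the product [X * R], which the library equips with the max norm. *)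
Definition C2_cone_reducible_set {V : normedModType R} (Theta : set V)
    (v0 : V) :=
  exists (O : set V) (W : euclideanType R) (C : set W) (h : V -> W),
    [/\ open O /\ O v0,
        pointed_closed_convex_cone C,
        C2_on O h,
        h v0 = 0 /\ (forall w, exists v, 'd h v0 v = w) &
        Theta `&` O = [set v | O v /\ C (h v)]].

(* For closed, proper, convex [f]; then [f u0] is finite whenever [dom f u0]. *)
Definition C2_cone_reducible {X : euclideanType R} (f : X -> \bar R)
    (u0 : X) :=
  dom f u0 /\ C2_cone_reducible_set (epi f) (u0, fine (f u0)).

End cone_reducibility.

Section solution_mappings.
Context {R : realType}.

Definition argmin {T : Type} (F : T -> \bar R) : set T :=
  [set x | forall y, (F x <= F y)%E].

(* The parameter [p.2] ranges over the reals rather than over (0, +oo); as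
   (0, +oo) is open, being single-valued (and Lipschitz) around a point with
   [0 < p.2] has the same meaning in both cases. *)
Definition solution {X Y : euclideanType R} (g : X -> \bar R)
    (p : 'Hom(X, Y) * Y * R) : set X :=
  argmin (fun x =>
    (((2 * p.2)^-1 * `|p.1.1 x - p.1.2| ^+ 2)%:E + g x)%E).

Definition single_valued_around {P : topologicalType} {T : Type}
    (S : P -> set T) (p0 : P) :=
  \forall p \near p0, exists x, S p = [set x].

Definition single_valued_Lipschitz_around {P X : normedModType R}
    (S : P -> set X) (p0 : P) :=
  exists (U : set P) (s : P -> X),
    [/\ nbhs p0 U, forall p, U p -> S p = [set s p] &
        [lipschitz s p | p in U]].

End solution_mappings.

(* Main.v *)
(* Write f = g^*; then x solves the problem for (A, b, mu) iff x is a subgradient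
   of f at the dual point z = A^*(b - A x) / mu.

   (i) => (ii): near vbar = (zbar, f zbar) the epigraph of f is h^-1(C) with h a
   submersion, so an epigraph normal (x, -1) at v = (z, f z) kills ker h'(v)
   (Graves' theorem), i.e. it equals y o h'(v) for a multiplier y. As h' is
   locally Lipschitz, the difference of two subgradients x1, x2 at z1, z2 is, up
   to eps |x1 - x2| + K |z1 - z2|, orthogonal to the projection N of
   ker h'(vbar); and the orthogonal of N lies in par (df zbar), because the polar
   of the pointed cone C is generating. Under (i) this gives
   |x1 - x2| <= c (|A (x1 - x2)| + |z1 - z2|). Monotonicity of dg bounds
   |A (x1 - x2)|^2 by a multiple of |x1 - x2| |p1 - p2| for solutions at
   parameters p1, p2, whence the Lipschitz estimate. Existence of nearby solutions
   follows since the objective at pbar is larger on a small sphere than at xbar.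

   (vii) => (i): a nonzero u in ker A and par (df zbar) is the direction of a
   segment in df zbar; shrinking this segment towards xbar and shifting b
   accordingly yields a parameter near bbar with two solutions. *)

Require Import Defs.
From HB Require Import structures.
From mathcomp Require Import all_boot all_order all_algebra.
From mathcomp Require Import all_classical all_reals.
From mathcomp Require Import ereal topology tvs normedtype convex derive.
From mathcomp Require Import ring lra.

Set Implicit Arguments.
Unset Strict Implicit.
Unset Printing Implicit Defensive.

Import Order.TTheory GRing.Theory Num.Theory.
Import numFieldNormedType.Exports.

Local Open Scope classical_set_scope.
Local Open Scope ring_scope.

(** * Finite-dimensional preliminaries *)

(** The map [h] lives on [X * R] with the max norm, which is not Euclidean. The calculus is
    therefore stated for a normed space with a finite generating family of controlled coefficients
    ([bounded_span]), and only the target [W] is Euclidean. Since f may be discontinuous, z close to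
    zbar does not by itself bring (z, f z) close to vbar. Restricting to subgradients of norm at
    most m repairs this, as f is then m-Lipschitz between the points considered; hence the
    localization of all solutions around [xbar]. The eps in front of |x1 - x2| arises because
    multipliers at different points are compared through one right inverse of h'(vbar), which
    inverts the other derivatives only up to a small error. It is harmless because the constant c of
    the injectivity estimate is fixed before eps is chosen. Monotonicity alone would bound |A (x1 -
    x2)| only by the square root of |x1 - x2| |p1 - p2|; fed back into the coercive estimate, it
    yields a bound linear in |p1 - p2|. *)

Lemma convex_combE (R : pzRingType) (V : lmodType R) (x y : V) (t : R) :
  t *: y + (1 - t) *: x = x + t *: (y - x).
Proof. by rewrite scalerBr scalerBl scale1r addrCA addrA. Qed.

Lemma near_normP (R : realType) (V : normedModType R) (a : V) (P : V -> Prop) :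
  (\forall x \near a, P x) <->
  exists2 d : R, 0 < d & forall x, `|x - a| < d -> P x.
Proof.
split=> [/nbhs_normP[d /= d0 dP]|[d d0 dP]]; last apply/nbhs_normP; exists d => // x.
  by rewrite distrC => /dP.
by rewrite /ball_ /= distrC => /dP.
Qed.

Section euclidean_topology.
Context {R : realType}.
Implicit Types V W : euclideanType R.

Lemma inner0r V (x : V) : inner x 0 = 0.
Proof. by rewrite innerC inner0l. Qed.

Lemma innerNl V (x y : V) : inner (- x) y = - inner x y.
Proof. by rewrite -scaleN1r innerZl mulN1r. Qed.

Lemma innerNr V (x y : V) : inner x (- y) = - inner x y.
Proof. by rewrite innerC innerNl innerC. Qed.

Lemma ler_norm_inner V (x y : V) : `|inner x y| <= `|x| * `|y|.
Proof.
by rewrite ler_norml inner_CauchySchwarz andbT lerNl -innerNl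
  -[leRHS](congr1 ( *%R^~ `|y|) (normrN x)) inner_CauchySchwarz.
Qed.

Lemma sqr_normD V (x y : V) :
  `|x + y| ^+ 2 = `|x| ^+ 2 + 2 * inner x y + `|y| ^+ 2.
Proof.
rewrite !normr_inner innerDl !innerDr (innerC y x); ring.
Qed.

(** Quantitative finite dimension. Unlike a Euclidean structure, it passes to [V * R] with the max
    norm. *)
Definition bounded_span (V : normedModType R) :=
  exists n (e : 'I_n -> V) (k : R), 0 <= k /\
    forall v, exists c : 'I_n -> R,
      v = \sum_i c i *: e i /\ forall i, `|c i| <= k * `|v|.

Lemma euclidean_bounded_span V : bounded_span V.
Proof.
pose e := vbasis (@fullv R V).
have /choice[v vE] : forall i, exists v : V, forall x, coord e i x = inner v x.
  move=> i; have [v hv] := inner_riesz (linfun (coord e i : V -> R^o)).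
  by exists v => x; rewrite -hv lfunE.
exists (\dim {:V}), (fun i => e`_i), (\sum_i `|v i|); split; first exact: sumr_ge0.
move=> x; exists (fun i => coord e i x); split.
  exact: (coord_vbasis (memvf x)).
move=> i; rewrite vE (le_trans (ler_norm_inner _ _))// ler_wpM2r//.
by rewrite (bigD1 i)//= lerDl sumr_ge0.
Qed.

Lemma bounded_span_prod (V : normedModType R) :
  bounded_span V -> bounded_span (V * R)%type.
Proof.
move=> [n [e [k [k0 ek]]]].
exists n.+1, (fun i => if unlift ord0 i is Some j then (e j, 0) else (0, 1)).
exists (k + 1); split => [|[v t]]; first by rewrite addr_ge0.
have [c [vE cv]] := ek v.
exists (fun i => if unlift ord0 i is Some j then c j else t); split.
  rewrite big_ord_recl unlift_none; under eq_bigr do rewrite liftK.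
  rewrite [v in LHS]vE; apply/pair_equal_spec.
  split => /=.
    rewrite raddf_sum /= scaler0 add0r; by apply: eq_bigr => i _.
  rewrite raddf_sum /= big1 ?addr0 ?[RHS]mulr1// => i _; exact: scaler0.
move=> i; have vt : `|v| <= `|(v, t)| /\ `|t| <= `|(v, t)|.
  by rewrite !prod_normE /= !le_max !lexx orbT.
case: unliftP => [j|] _.
  rewrite (le_trans (cv j))// mulrDl mul1r -[leLHS]addr0 lerD//.
  by rewrite ler_wpM2l//; case: vt.
by rewrite (le_trans vt.2)// mulrDl mul1r lerDr mulr_ge0.
Qed.

(* Bounded sets are compact because linear coordinates on [V] are Lipschitz. *)
Lemma euclidean_compact V (A : set V) (r : R) :
  closed A -> (forall x, A x -> `|x| <= r) -> compact A.
Proof.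
move=> cA Ar; have [n [e [k [k0 ek]]]] := euclidean_bounded_span V.
pose f (c : 'rV[R]_n) : V := \sum_i c ord0 i *: e i.
have cf : continuous f.
  move=> c; apply: (cvg_big (@add_continuous V) (nbhs_filter c)) => i _.
  by apply: cvgZr_tmp; apply: (@coord_continuous R 1 n ord0 i c).
(* The coefficient bound of [bounded_span] shows that this bounded set of coefficient vectors
   already covers [A]. *)
pose K := [set c | A (f c)] `&` [set c : 'rV[R]_n | `|c| <= k * `|r|].
have cK : compact K.
  apply: bounded_closed_compact.
    exists (k * `|r|); split; first exact: num_real.
    by move=> x rx c [_ /= /le_trans]; apply; exact: ltW.
  apply: closedI; first by apply: preimage_closed => // c _; exact: cf.
  apply: (@preimage_closed 'rV[R]_n R (fun c => `|c|) [set x | x <= k * `|r|]).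
    by move=> c _; exact: norm_continuous.
  exact: closed_le.
have -> : A = f @` K.
  apply/seteqP; split => [x Ax|_ [c [Ac _] <-]//].
  have [c [xE cx]] := ek x.
  exists (\row_i c i); last by rewrite xE; apply: eq_bigr => i _; rewrite mxE.
  split => /=.
    rewrite (_ : f _ = x)// xE; apply: eq_bigr => i _; by rewrite mxE.
  rewrite [leLHS]/Num.norm /= mx_normrE; apply/bigmax_leP; split => [|[i j] _ /=].
    by rewrite mulr_ge0.
  rewrite mxE (le_trans (cx j))// ler_wpM2l//.
  by rewrite (le_trans (Ar _ Ax)) ?ler_norm.
by apply: continuous_compact => //; apply: continuous_subspaceT.
Qed.

Lemma closed_ball_compact V (x : V) (r : R) : compact [set y | `|y - x| <= r].
Proof.
apply: (@euclidean_compact _ _ (r + `|x|)) => [|y /= yr]; last first.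
  by rewrite -[y](subrK x) (le_trans (ler_normD _ _))// lerD2r.
apply: (@preimage_closed V R (fun y => `|y - x|) [set t | t <= r]) => [y _|].
  by apply: cvg_norm; apply: cvgB; [exact: cvg_id|exact: cvg_cst].
exact: closed_le.
Qed.

Lemma sphere_compact V (x : V) (r : R) : compact [set y | `|y - x| = r].
Proof.
apply: (subclosed_compact _ (@closed_ball_compact V x r)) => [|y /= ->//].
apply: (@preimage_closed V R (fun y => `|y - x|) [set t | t = r]) => [y _|].
  by apply: cvg_norm; apply: cvgB; [exact: cvg_id|exact: cvg_cst].
exact: closed_eq.
Qed.

Lemma lfun_continuous V W (A : 'Hom(V, W)) : continuous A.
Proof.
move=> x; apply/cvgrPdist_lt => e e0; apply/near_normP.
have k0 : 0 < opnorm A + 1 by rewrite ltr_wpDl// opnorm_ge0.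
exists (e / (opnorm A + 1)); first by rewrite divr_gt0.
move=> y; rewrite ltr_pdivlMr// mulrC => yx.
rewrite distrC -linearB (le_lt_trans (le_opnorm _ _))//.
by apply: le_lt_trans yx; rewrite ler_wpM2r// lerDl.
Qed.

End euclidean_topology.

(** * Convex functions, conjugates and minimizers *)

(** The nonempty traces on [K] of the real sublevel sets are nested, hence a filter base. A cluster
    point lies in all of them, as they are closed, and so is a minimizer. If there is no such trace,
    [F] is [+oo] on [K]. *)
Lemma lsc_compact_min (R : realType) (T : topologicalType) (F : T -> \bar R)
    (K : set T) :
  compact K -> K !=set0 -> (forall x, (-oo < F x)%E) ->
  (forall a : R, closed [set x | (F x <= a%:E)%E]) ->
  exists2 x, K x & forall y, K y -> (F x <= F y)%E.
Proof.
move=> cK [x0 Kx0] Fgt cF.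
pose D := [set a : R | exists2 y, K y & (F y <= a%:E)%E].
pose B a := K `&` [set x | (F x <= a%:E)%E].
have [D0|/set0P D0] := eqVneq D set0.
  exists x0 => // y Ky; case Fy : (F y) => [a||]; last 1 first.
  - by have := Fgt y; rewrite Fy.
  - suff : D a by rewrite D0.
    by exists y => //; rewrite Fy.
  - exact: leey.
have FF : ProperFilter (filter_from D B).
  apply: filter_from_proper; last by move=> a [y Ky Fy]; exists y.
  apply: filter_from_filter => // a b Da Db; exists (Num.min a b).
    by rewrite /Num.min; case: ifP.
  by move=> y [Ky /=]; rewrite EFin_min le_min => /andP[]; split; split.
have [a Da] := D0.
have [|x [Kx clx]] := cK _ FF; first by exists a => // y [].
have xD b : D b -> (F x <= b%:E)%E.
  move=> Db; apply: (cF b).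
  have : closure (B b) x by move=> U; apply: clx; exists b.
  by apply: closure_subset => y [].
exists x => // y Ky; case Fy : (F y) => [b||]; last 1 first.
- by have := Fgt y; rewrite Fy.
- by apply: xD; exists y => //; rewrite Fy.
- exact: leey.
Qed.

Lemma ge0_small_affine (R : realFieldType) (a b : R) :
  (forall t, 0 < t -> t <= 1 -> 0 <= a + t * b) -> 0 <= a.
Proof.
move=> h; rewrite leNgt; apply/negP => a0.
have d0 : 0 < 1 + `|b| - a by rewrite subr_gt0 (lt_le_trans a0)// addr_ge0.
pose t := - a / (1 + `|b| - a).
have t0 : 0 < t by rewrite divr_gt0// oppr_gt0.
have t1 : t <= 1 by rewrite ler_pdivrMr// mul1r; have := normr_ge0 b; lra.
have tE : t * (1 + `|b| - a) = - a by rewrite mulrVK// unitfE gt_eqF.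
have := h t t0 t1; have := ler_wpM2l (ltW t0) (ler_norm b).
nra.
Qed.

Section convex_functions.
Context {R : realType} {X : euclideanType R}.
Implicit Types (g : X -> \bar R) (x y z : X).

Lemma convex_fun_le g x y (a b t : R) : convex_fun g ->
  0 <= t -> t <= 1 -> (g x <= a%:E)%E -> (g y <= b%:E)%E ->
  (g (t *: x + (1 - t) *: y)%R <= (t * a + (1 - t) * b)%:E)%E.
Proof.
move=> cg t0 t1 gx gy.
have t01 : Itv.spec (@Itv.num_sem R) (Itv.Real `[0%Z, 1%Z]) t.
  by rewrite /Itv.num_sem /= num_real in_itv /= t0 t1.
have := cg (x, a) (y, b) (Itv.mk t01).
by rewrite !inE /epi /= => /(_ gx gy).
Qed.

Lemma proper_fun_fin g x : proper_fun g -> dom g x -> exists a : R, g x = a%:E.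
Proof.
move=> [_ gN] gx; exists (fine (g x)); rewrite fineK//.
by rewrite fin_numElt gN.
Qed.

(* [a] is the value of [g] at [x]; quantifying over real upper bounds [b] of
   [g y] avoids extended-real arithmetic. *)
Definition fin_subgrad g x z (a : R) :=
  g x = a%:E /\ forall y (b : R), (g y <= b%:E)%E -> a + inner z (y - x) <= b.

Lemma fin_subgradP g x z : proper_fun g ->
  subdifferential g x z <-> exists a, fin_subgrad g x z a.
Proof.
move=> pg; split => [zx|[a [gx h]] y]; last first.
  rewrite gx; have := (pg.2 y); case gy : (g y) => [b||]//; last by rewrite leey.
  by rewrite -EFinD lee_fin => _; apply: h; rewrite gy.
have [[x0 gx0] gN] := pg; have [b gb] := proper_fun_fin pg gx0.
have [a ga] : exists a : R, g x = a%:E.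
  apply: (proper_fun_fin pg); rewrite /dom /= ltey; apply/eqP => gx.
  by have := zx x0; rewrite gx gb.
exists a; split => // y c gy; have := zx y; rewrite ga.
by move=> /le_trans/(_ gy); rewrite -EFinD lee_fin.
Qed.

Lemma fenchel_conj_leP g z (a : R) : proper_fun g ->
  (fenchel_conj g z <= a%:E)%E <->
  forall x (b : R), (g x <= b%:E)%E -> inner z x - b <= a.
Proof.
move=> pg; split => [zx x b gb|h].
  have : ((inner z x)%:E - g x <= a%:E)%E.
    by apply: le_trans zx; apply: ereal_sup_ubound; exists x.
  have := pg.2 x; case gx : (g x) gb => [c||]//; rewrite -EFinB !lee_fin; lra.
apply: ge_ereal_sup => _ [x _ <-].
have := pg.2 x; case gx : (g x) => [c||]//= _; last by rewrite addeNy leNye.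
by rewrite -EFinB lee_fin; apply: h; rewrite gx.
Qed.

Lemma fenchel_conj_proper g x z (a : R) : proper_fun g -> fin_subgrad g x z a ->
  proper_fun (fenchel_conj g).
Proof.
Proof.
move=> pg [gx h]; split=> [|w].
  exists z; apply: (@le_lt_trans _ _ (inner z x - a)%:E); last exact: ltry.
  apply/fenchel_conj_leP => // y b /h; rewrite innerBr; lra.
apply: (@lt_le_trans _ _ (inner w x - a)%:E); first exact: ltNyr.
by apply: ereal_sup_ubound; exists x => //; rewrite gx.
Qed.

(** Equality in the Fenchel-Young inequality: the subgradient inequality at [x] says that the
    supremum defining the conjugate at [z] is attained at [x]. *)
Lemma fin_subgrad_conj g x z (a : R) : proper_fun g -> fin_subgrad g x z a ->
  fin_subgrad (fenchel_conj g) z x (inner z x - a).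
Proof.
move=> pg [gx h]; split.
  apply/le_anti/andP; split.
    apply/fenchel_conj_leP => // y b gb; have := h y b gb; rewrite innerBr; lra.
  by apply: ereal_sup_ubound; exists x => //; rewrite gx.
move=> w b /(fenchel_conj_leP _ _ pg) /(_ x a).
by rewrite gx => /(_ (lexx _)); rewrite innerBr !(innerC x); lra.
Qed.


Lemma fin_subgrad_mono g x1 z1 a1 x2 z2 a2 :
  fin_subgrad g x1 z1 a1 -> fin_subgrad g x2 z2 a2 ->
  0 <= inner (x1 - x2) (z1 - z2).
Proof.
move=> [g1 h1] [g2 h2].
have := h1 x2 a2; have := h2 x1 a1; rewrite g1 g2 !lexx => /(_ isT) + /(_ isT).
rewrite !innerBr !innerBl !(innerC x1) !(innerC x2); lra.
Qed.

End convex_functions.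

(** * Optimality conditions and existence of solutions *)

Section solutions.
Context {R : realType} {X Y : euclideanType R}.
Variable g : X -> \bar R.
Hypotheses (g_closed : closed_fun g) (g_proper : proper_fun g)
  (g_convex : convex_fun g).
Implicit Types (p : 'Hom(X, Y) * Y * R) (x y z : X).

Definition residual_term p x : R := (2 * p.2)^-1 * `|p.1.1 x - p.1.2| ^+ 2.

(** The linear coefficient is minus the dual point paired with [d], and the quadratic one is
    nonnegative; the optimality condition and the convexity of the residual are both read off from
    this. *)
Lemma residual_termD p x d (t : R) : 0 < p.2 ->
  residual_term p (x + t *: d) = residual_term p x
   - t * inner (p.2^-1 *: adjoint p.1.1 (p.1.2 - p.1.1 x)) d
   + t ^+ 2 * ((2 * p.2)^-1 * `|p.1.1 d| ^+ 2).
Proof.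
case: p => [[A b] mu] /= mu0; rewrite /residual_term /=.
rewrite linearD linearZ /= addrAC sqr_normD normrZ exprMn real_normK ?num_real//.
rewrite innerZl -(opprB (A x) b) (innerC _ d) -adjointE innerNr innerZr (innerC (A d)).
by field; rewrite gt_eqF.
Qed.

Lemma solutionP p x : solution g p x <-> exists a, g x = a%:E /\
  forall y (b : R), (g y <= b%:E)%E -> residual_term p x + a <= residual_term p y + b.
Proof.
split => [Sx|[a [gx h]] y]; last first.
  rewrite gx; have := (g_proper.2 y); case gy : (g y) => [b||]//; last first.
    by rewrite addey // leey.
  by rewrite -!EFinD lee_fin => _; apply: h; rewrite gy.
have [[x0 gx0] gN] := g_proper; have [b gb] := proper_fun_fin g_proper gx0.
have [a ga] : exists a : R, g x = a%:E.
  apply: (proper_fun_fin g_proper); rewrite /dom /= ltey; apply/eqP => gx.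
  by have := Sx x0; rewrite gx gb.
exists a; split => // y c gy; have := Sx y; rewrite ga.
move=> Sy; rewrite -lee_fin !EFinD (le_trans Sy)// leeD2l//.
Qed.

(** First-order optimality. One direction compares [x] with the points of the segment towards [y],
    divides by the step and lets it tend to 0; the other drops the nonnegative quadratic term of the
    expansion. *)
Lemma solution_subgrad p x : 0 < p.2 -> solution g p x <->
  exists a, fin_subgrad g x (p.2^-1 *: adjoint p.1.1 (p.1.2 - p.1.1 x)) a.
Proof.
move=> mu0; rewrite solutionP; split => -[a [gx h]]; exists a; split => // y b gy.
  set z := _ *: _.
  rewrite -subr_ge0 opprD addrA.
  apply: (@ge0_small_affine _ _ ((2 * p.2)^-1 * `|p.1.1 (y - x)| ^+ 2)).
  move=> t t0 t1.
  have ga : (g x <= a%:E)%E by rewrite gx.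
  have := h _ _ (convex_fun_le g_convex (ltW t0) t1 gy ga).
  rewrite convex_combE residual_termD// -/z; set c := _ * _ ^+ 2 => hh.
  have : 0 <= t * (b - a - inner z (y - x) + t * c) by nra.
  by rewrite pmulr_rge0.
have := h y b gy; have := residual_termD x (y - x) 1 mu0.
rewrite scale1r [x + _]addrC subrK => ->; rewrite expr1n !mul1r.
have : 0 <= (2 * p.2)^-1 * `|p.1.1 (y - x)| ^+ 2.
  by rewrite mulr_ge0 ?exprn_ge0// invr_ge0 mulr_ge0// ltW.
lra.
Qed.

Lemma residual_term_continuous p : continuous (residual_term p).
Proof.
Proof.
move=> x; apply: cvgM; first exact: cvg_cst.
under eq_fun do rewrite expr2; rewrite expr2.
suff cn : (`|p.1.1 y - p.1.2| @[y --> x] --> `|p.1.1 x - p.1.2|) by exact: cvgM.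
apply: cvg_norm; apply: cvgB; last exact: cvg_cst.
exact: lfun_continuous.
Qed.

(** The objective is lower semicontinuous because its sublevel sets are preimages of the closed set
    [epi g] under the continuous map [x |-> (x, a - residual_term p x)]. *)
Lemma solution_min p (K : set X) : compact K -> (K `&` dom g) !=set0 ->
  exists x a, [/\ K x, g x = a%:E & forall y (b : R), K y -> (g y <= b%:E)%E ->
    residual_term p x + a <= residual_term p y + b].
Proof.
move=> cK [x0 [Kx0 gx0]].
have pF : forall x, (-oo < (residual_term p x)%:E + g x)%E.
  by move=> x; have := g_proper.2 x; case: (g x) => [a||]; rewrite ?ltry ?ltNyr.
have [||x Kx xmin] := lsc_compact_min cK _ pF.
- by exists x0.
- move=> a; pose h x := (x, a - residual_term p x).
  have -> : [set x | ((residual_term p x)%:E + g x <= a%:E)%E] = h @^-1` epi g.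
    apply/seteqP; rewrite /epi /h /=; split => x /=;
      have := g_proper.2 x; case: (g x) => [b||]//; rewrite -?EFinD ?lee_fin; lra.
  apply: (@preimage_closed X (X * R)%type h) => // x _.
  have cr : a - residual_term p y @[y --> x] --> a - residual_term p x.
    by apply: (@cvgB _ R^o); [exact: cvg_cst|exact: residual_term_continuous].
  exact: (cvg_pair cvg_id cr).
have [b gb] := proper_fun_fin g_proper gx0.
have [a ga] : exists a : R, g x = a%:E.
  apply: (proper_fun_fin g_proper); rewrite /dom /= ltey; apply/eqP => gx.
  by have := xmin x0 Kx0; rewrite gx gb.
exists x, a; split => // y c Ky gy; rewrite -lee_fin !EFinD.
by have := xmin y Ky; rewrite ga => /le_trans; apply; rewrite leeD2l.
Qed.

Lemma residual_term_convex p x y (t : R) : 0 < p.2 -> 0 <= t -> t <= 1 ->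
  residual_term p (t *: y + (1 - t) *: x) <=
    t * residual_term p y + (1 - t) * residual_term p x.
Proof.
move=> mu0 t0 t1.
rewrite convex_combE; have := residual_termD x (y - x) 1 mu0.
rewrite scale1r [x + (y - x)]addrC subrK => ->; rewrite residual_termD//.
set c := (_ * _ ^+ 2).
have : 0 <= c by rewrite mulr_ge0 ?exprn_ge0// invr_ge0 mulr_ge0// ltW.
move=> c0; have := mulr_ge0 (mulr_ge0 t0 c0) (_ : 0 <= 1 - t).
by rewrite subr_ge0 => /(_ t1); lra.
Qed.

(** By convexity, a point outside the open ball that is no worse than [x0] would yield a point of
    the sphere that is no worse than [x0]. Hence a minimizer over the compact ball is a global
    one. *)
Lemma solution_in_ball p x0 (a0 r : R) : 0 < p.2 -> 0 < r -> g x0 = a0%:E ->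
  (forall x (b : R), `|x - x0| = r -> (g x <= b%:E)%E ->
    residual_term p x0 + a0 < residual_term p x + b) ->
  solution g p !=set0 /\ forall x, solution g p x -> `|x - x0| < r.
Proof.
move=> mu0 r0 gx0 sph.
have inb y b : (g y <= b%:E)%E ->
    residual_term p y + b <= residual_term p x0 + a0 -> `|y - x0| < r.
  move=> gy yx; rewrite ltNge; apply/negP => ry.
  have ny0 : 0 < `|y - x0| by rewrite (lt_le_trans r0).
  pose t := r / `|y - x0|.
  have t0 : 0 <= t by rewrite divr_ge0// ltW.
  have t1 : t <= 1 by rewrite ler_pdivrMr// mul1r.
  have gx0' : (g x0 <= a0%:E)%E by rewrite gx0.
  have := sph _ _ _ (convex_fun_le g_convex t0 t1 gy gx0').
  have := residual_term_convex x0 y mu0 t0 t1.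
  rewrite [X in `|X - _|]convex_combE [X in `|X|]addrAC subrr add0r normrZ.
  rewrite ger0_norm// /t divfK ?gt_eqF// -/t => h1 /(_ erefl).
  have := ler_wpM2l t0 yx; lra.
split; last first.
  move=> x /solutionP[a [gx h]]; apply: (inb x a); first by rewrite gx.
  by apply: h; rewrite gx0.
have [|x [a [Kx gx h]]] := solution_min p (@closed_ball_compact R X x0 r).
  by exists x0; rewrite /= subrr normr0 ltW// /dom /= gx0 ltry.
exists x; apply/solutionP; exists a; split => // y b gy.
rewrite leNgt; apply/negP => lt_yx.
have [|yr] := leP `|y - x0| r; first by move=> /h/(_ gy); rewrite leNgt lt_yx.
have : `|y - x0| < r.
  apply: (inb y b gy); rewrite ltW// (lt_le_trans lt_yx)// h ?gx0//=.
  by rewrite subrr normr0 ltW.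
by rewrite ltNge ltW.
Qed.



End solutions.

(** * Proximal points and Fenchel duality *)

Section proximal_point.
Context {R : realType} {X : euclideanType R}.
Variable g : X -> \bar R.
Hypotheses (g_closed : closed_fun g) (g_proper : proper_fun g)
  (g_convex : convex_fun g).
Implicit Types x y z : X.

(** The hypothesis gives [g] an affine minorant, so adding half the squared distance to [x] makes
    the objective exceed its value at [x0] on a large sphere. The proximal problem is the solution
    problem with operator the identity, [b = x] and [mu = 1]. *)
Lemma prox_exists x z (c : R) :
  (forall y (b : R), (g y <= b%:E)%E -> inner z y - c <= b) ->
  exists y a, fin_subgrad g y (x - y) a.
Proof.
move=> gz; have [[x0 gx0] gN] := g_proper.
have [a0 ga0] := proper_fun_fin g_proper gx0.
pose p : 'Hom(X, X) * X * R := (\1%VF, x, 1).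
(* On the sphere of radius [r] about [x0], the objective exceeds its value at [x0] by at least r
   (r/2 - |x0 - x + z|) + [k]. This [r] makes the bracket equal to |k| + 1, with r >= 2. *)
pose k := inner z x0 - c - a0.
pose r := 2 * (`|x0 - x + z| + `|k| + 1).
have r0 : 0 < r by rewrite mulr_gt0// ltr_wpDl// addr_ge0.
have [y b yr gy|[y /(solution_subgrad g_proper g_convex (p := p) y ltr01)]] :=
  @solution_in_ball _ _ _ g g_closed g_proper g_convex p _ _ _ ltr01 r0 ga0; last first.
  move=> [a ha] _; exists y, a.
  suff -> : x - y = p.2^-1 *: adjoint p.1.1 (p.1.2 - p.1.1 y) by [].
  rewrite /= invr1 scale1r id_lfunE.
  apply/eqP; rewrite -subr_eq0; apply/eqP/inner_eq0.
  by rewrite innerBr -adjointE id_lfunE subrr.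
have := gz _ _ gy.
rewrite /residual_term /= !id_lfunE.
have -> : y - x = (y - x0) + (x0 - x) by rewrite addrA subrK.
rewrite (sqr_normD (y - x0)) yr.
have -> : inner z y = inner z (y - x0) + inner z x0 by rewrite innerBr subrK.
have h1 : - (r * `|x0 - x + z|) <= inner (y - x0) (x0 - x) + inner z (y - x0).
  rewrite (innerC z) -innerDr lerNl -yr -innerNl.
  by rewrite (le_trans (inner_CauchySchwarz _ _))// normrN.
have h2 : r * (r / 2 - `|x0 - x + z|) = r * (`|k| + 1) by rewrite /r; field.
have h3 : 2 * (`|k| + 1) <= r * (`|k| + 1).
  rewrite ler_wpM2r ?addr_ge0// /r.
  by have := normr_ge0 (x0 - x + z); have := normr_ge0 k; lra.
have h4 := ler_norm (- k); rewrite normrN /k in h4; have h5 := normr_ge0 k.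
rewrite -/k in h4; rewrite mulr1 => h6.
have -> : 2^-1 * (r ^+ 2 + 2 * inner (y - x0) (x0 - x) + `|x0 - x| ^+ 2) =
  r * (r / 2) + inner (y - x0) (x0 - x) + 2^-1 * `|x0 - x| ^+ 2 by field.
move: h1 h2 h3 h4 h5 h6; rewrite mulrBr /k; lra.
Qed.

(* Fenchel's duality [x \in dg^*(z) -> z \in dg(x)], obtained from the proximal
   point of [x + z] instead of the biconjugation theorem. *)
Lemma subgrad_conj_inv x z : dom (fenchel_conj g) z ->
  subdifferential (fenchel_conj g) z x -> exists a, fin_subgrad g x z a.
Proof.
move=> domz zx.
have gsz : (-oo < fenchel_conj g z)%E.
  have [[x0 gx0] gN] := g_proper; have [a ga] := proper_fun_fin g_proper gx0.
  apply: (@lt_le_trans _ _ (inner z x0 - a)%:E); first exact: ltNyr.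
  by apply: ereal_sup_ubound; exists x0 => //; rewrite ga.
have [c cE] : exists c : R, fenchel_conj g z = c%:E.
  by exists (fine (fenchel_conj g z)); rewrite fineK// fin_numElt gsz.
have [|y [a hy]] := @prox_exists (x + z) z c.
  have /(fenchel_conj_leP _ _ g_proper) h : (fenchel_conj g z <= c%:E)%E by rewrite cE.
  by move=> w b /h; lra.
have [gs _] := fin_subgrad_conj g_proper hy.
have : inner z y - a <= c.
  have /(fenchel_conj_leP _ _ g_proper) h : (fenchel_conj g z <= c%:E)%E by rewrite cE.
  by apply: h; rewrite hy.1.
(* As [x + z - y] is a subgradient of [g] at [y], the conjugate is known there. Testing the
   subgradient [x] at this point and using Fenchel-Young for [y] and [z] leaves |x - y|^2 <= 0. *)
have := zx (x + z - y); rewrite cE gs -EFinD lee_fin.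
have -> : x + z - y - z = x - y by rewrite addrAC addrK.
move=> h1 h2.
suff xy : x = y by exists a; move: hy; rewrite -xy addrAC subrr add0r.
apply/eqP; rewrite -subr_eq0 -normr_eq0 -sqrf_eq0 eq_le sqr_ge0 andbT normr_inner.
move: h1 h2; rewrite !(innerBr, innerBl, innerDl, innerDr) (innerC y); lra.
Qed.

End proximal_point.

(** * Continuously differentiable maps *)

Section calculus.
Context {R : realType}.
Implicit Types (V : normedModType R) (W : euclideanType R).

Lemma linear_sub_sum V W (S T : {linear V -> W}) n (c : 'I_n -> R) (E : 'I_n -> V) v :
  v = \sum_i c i *: E i -> S v - T v = \sum_i c i *: (S (E i) - T (E i)).
Proof.
move=> ->; rewrite (linear_sum S) (linear_sum T) -sumrB.
by apply: eq_bigr => i _; rewrite (linearZ_LR S) (linearZ_LR T) -scalerBr.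
Qed.

Lemma inner_is_diff W (q : W) (x : W) : is_diff x (inner q) (inner q).
Proof.
have h : linear (inner q : W -> R) by move=> a u v; rewrite innerDr innerZr.
pose H : {linear W -> R} := HB.pack (inner q : W -> R) (GRing.isLinear.Build _ _ _ _ _ h).
have cH : continuous H.
  move=> y; apply/cvgrPdist_lt => e e0; apply/near_normP.
  exists (e / (`|q| + 1)); first by rewrite divr_gt0// ltr_wpDl.
  move=> z; rewrite ltr_pdivlMr ?ltr_wpDl// => zy.
  rewrite -linearB (le_lt_trans (ler_norm_inner _ _))// distrC.
  by apply: le_lt_trans zy; rewrite mulrC ler_wpM2l// lerDl.
by apply: DiffDef; [exact: (linear_differentiable (f := H))|exact: (@diff_lin _ _ _ H)].
Qed.

(** The scalar mean value theorem applies after pairing with [q], the very vector to be bounded: the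
    increment of [f] is then |q|^2, and Cauchy-Schwarz cancels one factor. *)
Lemma mean_value_bound V W (F : V -> W) (a b : V) (w : W) (e : R) :
  (forall t : R, 0 <= t -> t <= 1 -> differentiable F (b + t *: (a - b)) /\
    `|'d F (b + t *: (a - b)) (a - b) - w| <= e) ->
  `|F a - F b - w| <= e.
Proof.
move=> hF; set u := a - b in hF *; set q := F a - F b - w.
pose f (t : R) : R := inner q (F (b + t *: u)) - t * inner q w.
pose f' (t : R) := inner q ('d F (b + t *: u) u - w).
have df (t : R) : 0 <= t -> t <= 1 -> is_derive t 1 f (f' t).
  move=> t0 t1; have [dF _] := hF t t0 t1.
  have dl : is_diff t (fun s : R => b + s *: u) (fun s => s *: u).
    apply: (@is_diff_eq _ _ _ _ _ _ _ (is_diffD (is_diff_cst b t) (is_diff_scalel t u))).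
    by apply/funext => s; rewrite /= add0r.
  have dq := inner_is_diff q (F (b + t *: u)).
  have dFd : is_diff (b + t *: u) F ('d F (b + t *: u)) by exact: DiffDef.
  have d1 := @is_diff_comp _ _ _ _ _ _ _ _ _ (is_diff_comp dl dFd) dq.
  have d2 := is_diffB d1 (is_diff_scalel t (inner q w : R^o)).
  have d3 : differentiable f t by case: d2.
  apply: DeriveDef; first exact: diff_derivable.
  rewrite deriveE//; have [_ dE] := d2.
  apply: (etrans (congr1 (fun k : R -> R => k 1) dE)).
  rewrite -[LHS]/(inner q ('d F (b + t *: u) (1 *: u)) - 1 *: inner q w).
  by rewrite !scale1r -innerBr.
have [c c01] : exists2 c, c \in `[0, 1]%R & f 1 - f 0 = f' c * (1 - 0).
  apply: MVT_segment => //.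
    by move=> x; rewrite in_itv /= => /andP[/ltW ? /ltW ?]; exact: df.
  apply: derivable_within_continuous => x; rewrite in_itv /= => /andP[x0 x1].
  by have := df x x0 x1; exact: @ex_derive.
rewrite /f scale1r scale0r addr0 mul0r mul1r subr0 subr0 mulr1.
have -> : b + u = a by rewrite addrC subrK.
have -> : inner q (F a) - inner q w - inner q (F b) = `|q| ^+ 2.
  by rewrite normr_inner -!innerBr /q addrAC.
move: c01; rewrite in_itv /= => /andP[c0 c1] qE.
have [q0|q0] := eqVneq q 0.
  by rewrite q0 normr0 (le_trans _ (hF 0 _ _).2).
rewrite -(@ler_pM2l _ `|q|) ?normr_gt0// -expr2 qE /f'.
rewrite (le_trans (inner_CauchySchwarz _ _))// ler_wpM2l//.
by have [] := hF c c0 c1.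
Qed.

(** In finite dimension, continuity in each direction gives continuity in operator norm: it suffices
    to control the finitely many generators. *)
Lemma linear_family_near V W (T : topologicalType) (G : T -> {linear V -> W})
    (t0 : T) (e : R) :
  bounded_span V -> 0 < e ->
  (forall v, {for t0, continuous (fun t => G t v)}) ->
  \forall t \near t0, forall v, `|G t v - G t0 v| <= e * `|v|.
Proof.
move=> [n [E [k [k0 hE]]]] e0 cG.
have d0 : 0 < e / (k * n%:R + 1) by rewrite divr_gt0// ltr_wpDl// mulr_ge0.
have : \forall t \near t0, forall i, `|G t (E i) - G t0 (E i)| < e / (k * n%:R + 1).
  apply: filter_forall => i.
  have /cvgrPdist_lt /(_ _ d0) := cG (E i).
  by apply: filterS => t; rewrite distrC.
apply: filterS => t ht v; have [c [vE cv]] := hE v.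
rewrite (linear_sub_sum _ _ vE).
rewrite (le_trans (ler_norm_sum _ _ _))//.
apply: (@le_trans _ _ (\sum_(i < n) k * `|v| * (e / (k * n%:R + 1)))).
  apply: ler_sum => i _; rewrite normrZ ler_pM//.
  exact: ltW.
rewrite sumr_const card_ord -[_ *+ n]mulr_natr.
have -> : k * `|v| * (e / (k * n%:R + 1)) * n%:R =
  e * `|v| * (k * n%:R / (k * n%:R + 1)) by ring.
rewrite -[leRHS]mulr1 ler_wpM2l ?(mulr_ge0 (ltW e0))//.
by rewrite ler_pdivrMr ?mul1r ?lerDl// ltr_wpDl// mulr_ge0.
Qed.

Lemma segment_near V (v0 a b : V) (d t : R) : 0 <= t -> t <= 1 ->
  `|a - v0| < d -> `|b - v0| < d -> `|b + t *: (a - b) - v0| < d.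
Proof.
move=> t0 t1 ad bd.
have -> : b + t *: (a - b) - v0 = t *: (a - v0) + (1 - t) *: (b - v0).
  rewrite -convex_combE !scalerBr addrACA -opprD -scalerDl.
  by rewrite [t + _]addrC subrK scale1r.
rewrite (le_lt_trans (ler_normD _ _))// !normrZ ger0_norm// ger0_norm ?subr_ge0//.
have [t0'|t0'] := eqVneq t 0; first by rewrite t0' mul0r subr0 mul1r add0r.
have : t * `|a - v0| < t * d by rewrite ltr_pM2l// lt_neqAle eq_sym t0'.
have : (1 - t) * `|b - v0| <= (1 - t) * d by rewrite ler_wpM2l ?subr_ge0// ltW.
lra.
Qed.

Lemma strict_differentiability V W (F : V -> W) (v0 : V) (e : R) :
  bounded_span V -> 0 < e ->
  (\forall x \near v0, differentiable F x) ->
  (forall v, {for v0, continuous (fun y => 'd F y v)}) ->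
  exists2 d : R, 0 < d & forall a b, `|a - v0| < d -> `|b - v0| < d ->
    `|F a - F b - 'd F v0 (a - b)| <= e * `|a - b|.
Proof.
move=> bV e0 dF cF.
have /near_normP[d d0 hd] : \forall y \near v0, differentiable F y /\
    forall v, `|'d F y v - 'd F v0 v| <= e * `|v|.
  by apply: filterI => //; apply: (@linear_family_near _ _ _ (fun y => 'd F y)).
exists d => // a b ad bd; apply: mean_value_bound => t t0 t1.
by have [] := hd _ (segment_near t0 t1 ad bd).
Qed.

Lemma linear_bounded_span V (W : normedModType R) (T : {linear V -> W}) : bounded_span V ->
  exists2 k : R, 0 <= k & forall v, `|T v| <= k * `|v|.
Proof.
move=> [n [E [k [k0 hE]]]]; exists (\sum_i k * `|T (E i)|).
  by apply: sumr_ge0 => i _; rewrite mulr_ge0.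
move=> v; have [c [vE cv]] := hE v.
rewrite [in leLHS]vE linear_sum mulr_suml (le_trans (ler_norm_sum _ _ _))//.
by apply: ler_sum => i _; rewrite linearZ /= normrZ mulrAC ler_wpM2r.
Qed.

(** Here the continuity of the second derivatives enters: each [y |-> 'd h y (E i)] is strictly
    differentiable at [v0], hence Lipschitz nearby, and the generators [E i] give the operator
    bound. *)
Lemma differential_Lipschitz V W (O : set V) (h : V -> W) (v0 : V) :
  bounded_span V -> open O -> O v0 -> C2_on O h ->
  exists (d k : R), [/\ 0 < d, 0 <= k & forall a b, `|a - v0| < d ->
    `|b - v0| < d -> forall v, `|'d h a v - 'd h b v| <= k * `|a - b| * `|v|].
Proof.
move=> bV oO Ov0 hC2; have [n [E [k [k0 hE]]]] := bV.
have nO : \forall x \near v0, O x by exact: open_nbhs_nbhs.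
have hi i : exists m : R * R, [/\ 0 < m.1, 0 <= m.2 & forall a b,
    `|a - v0| < m.1 -> `|b - v0| < m.1 ->
    `|'d h a (E i) - 'd h b (E i)| <= m.2 * `|a - b|].
  have [d d0 hd] := @strict_differentiability V W (fun y => 'd h y (E i)) v0 1
    bV ltr01 (filterS (fun x Ox => let: And3 _ D _ := hC2 x Ox in D (E i)) nO)
    (fun v => let: And3 _ _ D := hC2 v0 Ov0 in D (E i) v).
  have [m m0 hm] := linear_bounded_span ('d (fun y => 'd h y (E i)) v0) bV.
  exists (d, 1 + m); split; rewrite //= ?addr_ge0// => a b ad bd.
  rewrite -[X in `|X|](subrK ('d (fun y => 'd h y (E i)) v0 (a - b))).
  by rewrite (le_trans (ler_normD _ _))// mulrDl lerD ?hd.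
have /choice[m hm] := hi.
have nd : \forall x \near v0, forall i, `|x - v0| < (m i).1.
  apply: filter_forall => i; apply/near_normP; exists (m i).1 => //.
  by have [] := hm i.
have /near_normP[d d0 hd] := nd.
exists d, (\sum_i k * (m i).2); split => // [|a b ad bd v].
  by apply: sumr_ge0 => i _; have [_ ? _] := hm i; rewrite mulr_ge0.
have [c [vE cv]] := hE v.
rewrite (linear_sub_sum _ _ vE) (le_trans (ler_norm_sum _ _ _))//.
rewrite !mulr_suml ler_sum// => i _; rewrite normrZ.
have [_ _ /(_ a b (hd a ad i) (hd b bd i)) hab] := hm i.
rewrite (le_trans (ler_pM _ _ (cv i) hab))//; nra.
Qed.

End calculus.

(** * Graves' theorem and normals to a preimage *)

Section metric_regularity.
Context {R : realType}.
Implicit Types (V : normedModType R) (W : euclideanType R).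

Lemma Lipschitz_compact_min V (K : set V) (f : V -> R) (k : R) :
  compact K -> K !=set0 ->
  (forall x y, K x -> K y -> `|f x - f y| <= k * `|x - y|) ->
  exists2 x, K x & forall y, K y -> f x <= f y.
Proof.
move=> cK K0 fk; have [|x /set_mem Kx xm] := compact_EVT_min (f := f) K0 cK.
  apply/subspace_continuousP => x Kx; apply/cvgrPdist_lt => e e0.
  rewrite near_withinE; apply/near_normP.
  have k0 : 0 < `|k| + 1 by rewrite ltr_wpDl.
  exists (e / (`|k| + 1)); first by rewrite divr_gt0.
  move=> y; rewrite ltr_pdivlMr// mulrC => yx Ky.
  rewrite (le_lt_trans (fk _ _ Kx Ky))// distrC (le_lt_trans _ yx)//.
  by rewrite ler_wpM2r// (le_trans (ler_norm k))// lerDl.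
by exists x => // y Ky; apply: xm; rewrite inE.
Qed.

(* Graves' theorem: [q] minimizing the residual over a ball of radius
   proportional to [w] must solve [h (v + B q) = h v + w], since the Newton-like
   step [q + residual] would otherwise halve the residual. *)
Lemma Graves V W (h : V -> W) (v0 : V) (T : {linear V -> W})
    (B : {linear W -> V}) (k : R) :
  0 <= k -> (forall w, `|B w| <= k * `|w|) -> (forall w, T (B w) = w) ->
  (forall e : R, 0 < e -> exists2 d : R, 0 < d & forall a b, `|a - v0| < d ->
     `|b - v0| < d -> `|h a - h b - T (a - b)| <= e * `|a - b|) ->
  exists2 r : R, 0 < r & forall v w, `|v - v0| < r -> `|w| < r ->
    exists2 v', h v' = h v + w & `|v' - v| <= 4 * k * `|w|.
Proof.
move=> k0 Bk TB hT; have k1 : 0 < k + 1 by rewrite ltr_wpDl.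
(* With this precision, [q |-> h (v + B q) - q] contracts by 1/2. The minimizer then satisfies |q|
   <= 4 |w| and has residual at most |w|, so the ball of radius 5 |w| leaves room for the extra
   step. The radius d / (10 (k + 1)) keeps all points within [d] of [v0]. *)
have e0 : 0 < (2 * (k + 1))^-1 by rewrite invr_gt0 mulr_gt0.
have [d d0 hd] := hT _ e0.
have r0 : 0 < d / (10 * (k + 1)) by rewrite divr_gt0// mulr_gt0.
have rE : (d / (10 * (k + 1))) * (10 * (k + 1)) = d by rewrite divfK// gt_eqF// mulr_gt0.
exists (d / (10 * (k + 1))) => // v w vr wr.
set r := d / _ in r0 rE vr wr; clearbody r.
pose K := [set q : W | `|q - 0| <= 5 * `|w|].
pose c := h v + w.
have contr q1 q2 : K q1 -> K q2 ->
    `|h (v + B q1) - h (v + B q2) - (q1 - q2)| <= 2^-1 * `|q1 - q2|.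
  rewrite /K /= !subr0 => Kq1 Kq2.
  have near q : `|q| <= 5 * `|w| -> `|v + B q - v0| < d.
    move=> Kq; rewrite addrAC (le_lt_trans (ler_normD _ _))//.
    have := Bk q; have := ler_wpM2l k0 Kq; have : k * `|w| <= k * r by rewrite ler_wpM2l// ltW.
    have := mulr_ge0 k0 (ltW r0); nra.
  have -> : q1 - q2 = T (v + B q1 - (v + B q2)).
    by rewrite opprD addrACA subrr add0r -linearB /= TB.
  rewrite (le_trans (hd _ _ (near _ Kq1) (near _ Kq2)))//.
  rewrite opprD addrACA subrr add0r -linearB /= TB.
  rewrite (le_trans (ler_wpM2l (ltW e0) (Bk _)))// mulrA ler_wpM2r//.
  by rewrite invfM -mulrA ler_piMr ?invr_ge0// mulrC ler_pdivrMr// mul1r lerDl.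
have K0 : K 0 by rewrite /K /= subrr normr0 mulr_ge0.
have [||q Kq qmin] := @Lipschitz_compact_min _ K
    (fun q => `|h (v + B q) - c|) (3 / 2) (@closed_ball_compact _ _ _ _).
- by exists 0.
- move=> q1 q2 Kq1 Kq2; rewrite (le_trans (ler_dist_dist _ _))//.
  rewrite opprB addrA subrK.
  rewrite -[X in `|X|](subrK (q1 - q2)) (le_trans (ler_normD _ _))//.
  have := contr _ _ Kq1 Kq2; lra.
have qw : `|h (v + B q) - c| <= `|w|.
  have := qmin 0 K0; rewrite linear0 addr0.
  by rewrite [X in _ <= `|X|](_ : _ = - w) ?normrN// /c opprD addrA subrr sub0r.
have q4 : `|q| <= 4 * `|w|.
  have := contr _ _ Kq K0; rewrite linear0 addr0 subr0 => h1.
  have : `|q| <= `|h (v + B q) - h v - q| + `|h (v + B q) - c| + `|w|.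
    rewrite -{1}[q](subKr (h (v + B q) - h v)) (le_trans (ler_normB _ _))//.
    have hAH : `|h (v + B q) - h v| <= `|h (v + B q) - c| + `|w|.
      have -> : h (v + B q) - h v = h (v + B q) - c + w by rewrite opprD addrA subrK.
      exact: ler_normD.
    lra.
  lra.
pose s := c - h (v + B q).
have Ks : K (q + s).
  rewrite /K /= subr0 (le_trans (ler_normD _ _))// /s distrC; lra.
have := qmin _ Ks; have := contr _ _ Ks Kq.
rewrite [q + s - q]addrAC subrr add0r.
have -> : h (v + B (q + s)) - h (v + B q) - s = h (v + B (q + s)) - c.
  by rewrite /s opprB addrA subrK.
have sE : `|s| = `|h (v + B q) - c| by rewrite distrC.
move=> h1 h2; have : `|s| <= 0 by lra.
rewrite normr_le0 subr_eq0 => /eqP cE.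
exists (v + B q); first by rewrite -cE.
rewrite addrAC subrr add0r (le_trans (Bk _))// -mulrA mulrCA.
by have := ler_wpM2l k0 q4; lra.
Qed.

(** The point [v + t *: d] satisfies the constraint only to first order. Regularity moves it by o(t)
    to a point whose image is exactly [h v + t *: 'd h v d]; that point lies in [Theta], and
    dividing by [t] gives the sign of [xi d]. *)
Lemma normal_tangent V W (O Theta : set V) (C : set W) (h : V -> W)
    (v0 : V) (r k : R) (xi : {linear V -> R^o}) (m : R) (v d : V) :
  0 < r -> 0 <= k -> (forall v w, `|v - v0| < r -> `|w| < r ->
    exists2 v', h v' = h v + w & `|v' - v| <= k * `|w|) ->
  open O -> Theta `&` O = [set v | O v /\ C (h v)] ->
  0 <= m -> (forall u, `|xi u| <= m * `|u|) ->
  (forall v', Theta v' -> xi (v' - v) <= 0) ->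
  `|v - v0| < r -> O v ->
  (forall e : R, 0 < e -> exists2 d : R, 0 < d & forall u, `|u| < d ->
     `|h (v + u) - h v - 'd h v u| <= e * `|u|) ->
  (forall t : R, 0 < t -> t <= 1 -> C (h v + t *: 'd h v d)) ->
  xi d <= 0.
Proof.
move=> r0 k0 hG oO OE m0 xim xi0 vr Ov hd hC.
rewrite leNgt; apply/negP => xid.
have nd1 : 0 < `|d| + 1 by rewrite ltr_wpDl.
have mk1 : 0 < m * k * (`|d| + 1) + 1 by rewrite ltr_wpDl// !mulr_ge0// ltW.
(* Chosen so that the correction costs [xi] less than half of [t * xi d]. *)
pose e := Num.min 1 (xi d / (2 * (m * k * (`|d| + 1) + 1))).
have e0 : 0 < e by rewrite lt_min ltr01 divr_gt0// mulr_gt0.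
have e1 : e <= 1 by rewrite ge_min lexx.
have eE : e * (2 * (m * k * (`|d| + 1) + 1)) <= xi d.
  by rewrite -ler_pdivlMr ?mulr_gt0// /e ge_min lexx orbT.
clearbody e.
have [d1 d10 hd1] := hd _ e0.
have /near_normP[d2 d20 hd2] : \forall x \near v, O x by apply: open_nbhs_nbhs.
(* The bounds serve, in turn, the expansion of [h], the membership of the corrected point in [O],
   the two conditions of the regularity estimate, and [t <= 1]. *)
pose D := Num.min (Num.min d1 (d2 / (k + 1))) (Num.min (r - `|v - v0|) (Num.min r 1)).
have D0 : 0 < D by rewrite !lt_min d10 subr_gt0 vr r0 ltr01 divr_gt0// ltr_wpDl.
pose t := D / (2 * (`|d| + 1)).
have t0 : 0 < t by rewrite divr_gt0// mulr_gt0.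
have tE : t * (`|d| + 1) = D / 2.
  by rewrite /t invfM mulrA divfK// gt_eqF.
have td : t * `|d| <= D / 2 by rewrite -tE ler_wpM2l ?lerDl// ltW.
have tD : t <= D / 2 by rewrite -tE ler_peMr ?lerDr// ltW.
have D1 : D <= d1 by rewrite /D !ge_min lexx.
have D2 : D * (k + 1) <= d2.
  by rewrite -ler_pdivlMr ?ltr_wpDl// /D !ge_min lexx orbT.
have D3 : D <= r - `|v - v0| by rewrite /D !ge_min lexx !orbT.
have D4 : D <= r by rewrite /D !ge_min lexx !orbT.
have D5 : D <= 1 by rewrite /D !ge_min lexx !orbT.
clearbody D.
have ntd : `|t *: d| = t * `|d| by rewrite normrZ gtr0_norm.
have h1 : `|h (v + t *: d) - h v - t *: 'd h v d| <= e * (t * `|d|).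
  by rewrite -ntd -linearZ hd1// ntd; lra.
set w := h v + t *: 'd h v d - h (v + t *: d).
have wE : `|w| <= e * (t * `|d|).
  by rewrite (le_trans _ h1)// -normrN /w !opprD !opprK addrC addrA.
have td0 : 0 <= t * `|d| by rewrite mulr_ge0// ltW.
have wD : `|w| <= D / 2 by rewrite (le_trans wE)// (le_trans _ td)// ler_piMl.
have [||v' v'E v'k] := hG (v + t *: d) w.
- by rewrite addrAC (le_lt_trans (ler_normD _ _))// ntd; lra.
- by rewrite (le_lt_trans wD)//; lra.
have v'v : `|v' - v| < d2.
  have -> : v' - v = v' - (v + t *: d) + t *: d by rewrite opprD addrA subrK.
  rewrite (le_lt_trans (ler_normD _ _))// ntd.
  have := ler_wpM2l k0 wD; lra.
have Tv' : Theta v'.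
  suff : (Theta `&` O) v' by case.
  rewrite OE; split; first exact: hd2.
  rewrite v'E /w addrCA subrr addr0; apply: hC => //; lra.
have := xi0 _ Tv'.
have -> : v' - v = (v' - (v + t *: d)) + t *: d by rewrite opprD addrA subrK.
rewrite linearD linearZ /= => h2.
have h3 : - (m * (k * (e * (t * `|d|)))) <= xi (v' - (v + t *: d)).
  rewrite lerNl (le_trans (ler_norm _))// normrN (le_trans (xim _))//.
  by rewrite ler_wpM2l// (le_trans v'k)// ler_wpM2l.
have h4 : t * (xi d - m * k * e * `|d|) <= 0.
  move: h2 h3; rewrite -[t *: xi d]/(t * xi d); lra.
have : xi d <= m * k * e * `|d| by move: h4; rewrite pmulr_rle0// subr_le0.
have mke : 0 <= m * k * e by rewrite !mulr_ge0// ltW.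
have := mulr_ge0 mke (normr_ge0 d); lra.
Qed.

End metric_regularity.

(** * Polar cones *)

Section linear_algebra.
Context {R : realType}.
Implicit Types W : euclideanType R.

Lemma inner_sumr W I (r : seq I) (F : I -> W) w :
  inner w (\sum_(i <- r) F i) = \sum_(i <- r) inner w (F i).
Proof. by apply: (big_morph (inner w)) => [x y|]; rewrite ?innerDr ?inner0r. Qed.

(** [T^-1] inverts [T] on its image, so [d] and [T^-1 (T d)] differ by a kernel element, which [xi]
    ignores; [y] represents [xi] composed with [T^-1]. *)
Lemma linear_factor (V : vectType R) W (T : 'Hom(V, W)) (xi : 'Hom(V, R^o)) :
  (forall d, T d = 0 -> xi d = 0) -> exists y, forall d, xi d = inner y (T d).
Proof.
move=> xiT; have [y hy] := inner_riesz (xi \o T^-1)%VF.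
exists y => d; rewrite -hy comp_lfunE; apply/eqP; rewrite -subr_eq0 -linearB /=.
by rewrite xiT// linearB /= limg_lfunVK ?subrr// memv_img ?memvf.
Qed.

(** A list in [D] whose span has maximal dimension spans all of [D]; it remains to see that this
    span is the whole space. *)
Lemma orthogonal_subspace_full W (D : set W) :
  D 0 -> (forall a x y, D x -> D y -> D (a *: x + y)) ->
  (forall w, (forall y, D y -> inner y w = 0) -> w = 0) -> forall y, D y.
Proof.
move=> D0 Dl Dw.
pose P n := `[< exists s : seq W, {in s, forall u, D u} /\ (\dim <<s>> == n)%VS >].
have exP : exists n, P n.
  by exists (\dim <<([::] : seq W)>>%VS); apply/asboolP; exists [::].
have ubP n : P n -> (n <= \dim {:W})%N.
  by move=> /asboolP[s [_ /eqP <-]]; rewrite dimvS// subvf.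
have [n /asboolP[s [sD /eqP sn]] nmax] := ex_maxnP exP ubP.
have Ds y : y \in <<s>>%VS -> D y.
  move=> ys; rewrite (coord_span (X := in_tuple s) ys).
  elim/big_ind : _ => // [x z Dx Dz|i _].
    by rewrite -[x]scale1r; exact: Dl.
  rewrite -[X in D X]addr0; apply: Dl => //; apply: sD; exact: mem_nth.
have sDy y : D y -> y \in <<s>>%VS.
  move=> Dy; apply/negPn/negP => ys.
  have : P (\dim <<y :: s>>%VS).
    apply/asboolP; exists (y :: s); split=> // u; rewrite in_cons => /predU1P[->//|].
    exact: sD.
  move=> /nmax; rewrite -sn leqNgt => /negP; apply.
  rewrite ltn_neqAle dimvS ?andbT ?span_cons ?addvSr//.
  apply: contra ys => /eqP e.
  have /eqP -> : (<<s>> == <[y]> + <<s>>)%VS by rewrite eqEdim addvSr e leqnn.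
  by apply/(subvP (addvSl _ _))/memv_line.
suff fs : <<s>>%VS = fullv by move=> y; apply: Ds; rewrite fs memvf.
pose e := vbasis <<s>>%VS.
(* A substitute for the projection onto the span, with no orthonormal basis required: its values lie
   in [<<s>>], and a vector in its kernel is orthogonal to [D], hence zero. Injectivity forces full
   dimension. *)
pose G x : W := \sum_(i < \dim <<s>>) inner e`_i x *: e`_i.
have Gl : linear G.
  move=> a x y; rewrite /G scaler_sumr -big_split /=; apply: eq_bigr => i _.
  by rewrite innerDr innerZr scalerDl scalerA.
pose GL : {linear W -> W} := HB.pack G (GRing.isLinear.Build _ _ _ _ _ Gl).
have k0 : lker (linfun GL) == 0%VS.
  rewrite -subv0; apply/subvP => w; rewrite memv_ker lfunE /= /G memv0 => /eqP Gw.
  apply/eqP; apply: Dw => y /sDy ys.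
  have ew (i : 'I_(\dim <<s>>)) : inner e`_i w = 0.
    have : \sum_(i < \dim <<s>>) (inner e`_i w) ^+ 2 = 0.
      rewrite -[RHS](inner0r w) -[in RHS]Gw inner_sumr.
      by apply: eq_bigr => j _; rewrite innerZr (innerC w).
    move=> /eqP; rewrite psumr_eq0 => [/allP/(_ i)|j _]; last exact: sqr_ge0.
    by rewrite mem_index_enum sqrf_eq0 => /(_ isT)/eqP.
  rewrite (coord_vbasis ys) innerC inner_sumr.
  by apply: big1 => j _; rewrite innerZr innerC ew mulr0.
apply/eqP; rewrite eqEdim subvf /=.
have := limg_dim_eq (f := linfun GL) (U := fullv).
rewrite (eqP k0) capv0 => /(_ erefl) <-; apply: dimvS.
apply/subvP => _ /memv_imgP[x _ ->]; rewrite lfunE /= /G.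
apply: memv_suml => i _; apply: memvZ; apply: vbasis_mem.
by rewrite mem_nth// size_tuple.
Qed.

End linear_algebra.

Section polar_cone.
Context {R : realType} {W : euclideanType R}.

Definition polar (C : set W) : set W := [set y | forall w, C w -> inner y w <= 0].

(** The proximal point [y] of the indicator of [C] is the projection of [w]. Since [C] is closed
    under addition, [w - y] is polar to [C]; orthogonality to [w] and the projection inequality at 0
    then give w = y. *)
Lemma cone_double_polar (C : set W) w : pointed_closed_convex_cone C ->
  (forall y, polar C y -> inner y w = 0) -> C w.
Proof.
move=> [cC coC kC pC] hw.
have C0 : C 0 by have : [set 0] (0 : W) by []; rewrite -pC => -[].
pose ind (x : W) : \bar R := if `[< C x >] then 0%:E else +oo%E.
have indE x (b : R) : (ind x <= b%:E)%E <-> C x /\ 0 <= b.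
  rewrite /ind; case: asboolP => Cx; rewrite ?lee_fin; first by split=> [|[]].
  by split=> [|[]//]; rewrite leye_eq.
have [||||y [a [ya hy]]] := @prox_exists R W ind _ _ _ w 0 0.
- have -> : closed_fun ind = closed ((fst @^-1` C) `&` (snd @^-1` [set t : R | 0 <= t])).
    by congr closed; apply/seteqP; rewrite /epi; split=> -[x b] /= /indE.
  apply: closedI.
    by apply: (@preimage_closed (W * R)%type W fst) => // x _; exact: cvg_fst.
  apply: (@preimage_closed (W * R)%type R snd) => [x _|]; first exact: cvg_snd.
  exact: closed_ge.
- split; first by exists 0; rewrite /dom /= /ind asboolT// ltry.
  by move=> x; rewrite /ind; case: asboolP => _; rewrite ?ltNyr.
- move=> [x b] [x' b'] t; rewrite !inE /epi /= => /indE[Cx b0] /indE[Cx' b'0].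
  apply/indE; split.
    by have := coC x x' t; rewrite !inE; apply.
  have t0 : 0 <= t%:num by [].
  have t1 : t%:num <= 1 by [].
  by apply: addr_ge0; apply: mulr_ge0 => //; rewrite subr_ge0.
- by move=> x b /indE[_ b0]; rewrite inner0l subr0.
have [Cy _] : C y /\ 0 <= a by apply/indE; rewrite ya.
have a0 : a = 0 by move: ya; rewrite /ind asboolT// => -[].
have hC c : C c -> inner (w - y) (c - y) <= 0.
  by move=> Cc; have := hy c 0; rewrite a0 add0r; apply; apply/indE.
have CD c : C c -> C (y + c).
  move=> Cc; have h2 : 0 <= (2^-1 : R) <= 1 by lra.
  have t01 : Itv.spec (@Itv.num_sem R) (Itv.Real `[0%Z, 1%Z]) 2^-1.
    by rewrite /Itv.num_sem /= num_real in_itv /=.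
  have := coC y c (Itv.mk t01); rewrite !inE => /(_ Cy Cc).
  move=> /(kC 2 _ (ler0n _ 2)); congr C.
  rewrite scalerDr !scalerA divff ?pnatr_eq0// scale1r; congr (_ + _).
  by rewrite -[RHS]scale1r; congr (_ *: _); rewrite /= /unstable.onem; field.
have Py : polar C (w - y).
  move=> c Cc; have := hC _ (CD _ Cc).
  by rewrite [y + c]addrC addrK.
have : inner (w - y) (w - y) <= 0.
  have := hC _ C0; have := hw _ Py; rewrite sub0r innerNr !innerBr; lra.
rewrite -normr_inner => h; have : `|w - y| ^+ 2 == 0 by rewrite eq_le h sqr_ge0.
by rewrite sqrf_eq0 normr_eq0 subr_eq0 => /eqP ->.
Qed.

(** The differences of polar vectors form a subspace. A vector orthogonal to it lies in [C] together
    with its opposite, by [cone_double_polar], so it vanishes by pointedness. *)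
Lemma polar_generating (C : set W) y : pointed_closed_convex_cone C ->
  exists p q, [/\ polar C p, polar C q & y = p - q].
Proof.
move=> hC; pose D := [set y | exists p q, [/\ polar C p, polar C q & y = p - q]].
have P0 : polar C 0 by move=> w _; rewrite inner0l.
have PD p q : polar C p -> polar C q -> polar C (p + q).
  by move=> hp hq w Cw; rewrite innerDl; have := hp w Cw; have := hq w Cw; lra.
have PZ (t : R) p : 0 <= t -> polar C p -> polar C (t *: p).
  by move=> t0 hp w Cw; rewrite innerZl; have := hp w Cw; nra.
suff : D y by [].
apply: orthogonal_subspace_full => {y}.
- by exists 0, 0; rewrite subrr.
- move=> t x y [p [q [hp hq ->]]] [p' [q' [hp' hq' ->]]].
  have [t0|t0] := leP 0 t.
    exists (t *: p + p'), (t *: q + q').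
    split; [by apply: PD => //; exact: PZ|by apply: PD => //; exact: PZ|].
    by rewrite scalerBr opprD addrACA.
  have nt0 : 0 <= - t by rewrite oppr_ge0 ltW.
  exists (- t *: q + p'), (- t *: p + q').
  split; [by apply: PD => //; exact: PZ|by apply: PD => //; exact: PZ|].
  by rewrite !scaleNr scalerBr opprD opprK [RHS]addrACA [- _ + t *: p]addrC.
- move=> w hw.
  have hP y : polar C y -> inner y w = 0.
    by move=> Py; apply: hw; exists y, 0; rewrite subr0.
  have Cw : C w by apply: cone_double_polar.
  have Cnw : C (- w).
    by apply: cone_double_polar => // y /hP; rewrite innerNr => ->; rewrite oppr0.
  have [_ _ _ pC] := hC.
  have : (C `&` [set - w | w in C]) w by split => //; exists (- w) => //; rewrite opprK.
  by rewrite pC.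
Qed.

End polar_cone.

(** * Normals to a reducible epigraph *)

Section epigraph_normals.
Context {R : realType} {X : euclideanType R}.
Implicit Types (f : X -> \bar R) (x z u : X).

(** The pairing with the epigraph normal (x, -1). *)
Definition normal_fun x (d : X * R) : R := inner x d.1 - d.2.

Lemma normal_fun_linear x : linear (normal_fun x : X * R -> R^o).
Proof.
move=> a d d'; rewrite /normal_fun /= innerDr innerZr.
rewrite -[a *: d.2]/(a * d.2) -[a *: (_ - _)]/(a * (inner x d.1 - d.2)); ring.
Qed.

HB.instance Definition _ x :=
  GRing.isLinear.Build R (X * R)%type R^o _ (normal_fun x) (normal_fun_linear x).

Lemma normal_fun_bound x d : `|normal_fun x d| <= (`|x| + 1) * `|d|.
Proof.
rewrite /normal_fun (le_trans (ler_normB _ _))// mulrDl mul1r lerD//.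
  by rewrite (le_trans (ler_norm_inner _ _))// ler_wpM2l// prod_normE le_max lexx.
by rewrite prod_normE le_max lexx orbT.
Qed.

Lemma normal_fun_le0 f z x a v : fin_subgrad f z x a -> epi f v ->
  normal_fun x (v - (z, a)) <= 0.
Proof.
by move=> [fz h] /h; rewrite /normal_fun /=; lra.
Qed.

End epigraph_normals.

Section reducible_epigraph.
Context {R : realType} {X W : euclideanType R}.
Variables (f : X -> \bar R) (zbar : X) (abar : R).
Variables (O : set (X * R)) (C : set W) (h : X * R -> W).
Let v0 : X * R := (zbar, abar).
Hypotheses (f_convex : convex_fun f) (fz : f zbar = abar%:E).
Hypotheses (oO : open O) (Ov0 : O v0) (C_cone : pointed_closed_convex_cone C).
Hypotheses (hC2 : C2_on O h) (h0 : h v0 = 0).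
Hypothesis h_surj : forall w, exists v, 'd h v0 v = w.
Hypothesis epiE : epi f `&` O = [set v | O v /\ C (h v)].

Let bXR : bounded_span (X * R)%type.
Proof. by apply: bounded_span_prod; exact: euclidean_bounded_span. Qed.

Lemma reducible_strict v (e : R) : O v -> 0 < e ->
  exists2 d : R, 0 < d & forall a b, `|a - v| < d -> `|b - v| < d ->
    `|h a - h b - 'd h v (a - b)| <= e * `|a - b|.
Proof.
move=> Ov e0; apply: strict_differentiability => //.
  have : \forall x \near v, O x by apply: open_nbhs_nbhs.
  by apply: filterS => x /hC2[].
move=> u; apply: differentiable_continuous.
by have [_ + _] := hC2 Ov; apply.
Qed.

Lemma reducible_strict0 v (e : R) : O v -> 0 < e ->
  exists2 d : R, 0 < d & forall u, `|u| < d ->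
    `|h (v + u) - h v - 'd h v u| <= e * `|u|.
Proof.
move=> Ov e0; have [d d0 hd] := reducible_strict Ov e0; exists d => // u ud.
have := hd (v + u) v; rewrite [v + u - v]addrAC subrr add0r normr0.
by apply.
Qed.

Lemma reducible_right_inverse : exists (B : {linear W -> (X * R)%type}) (k : R),
  [/\ 0 <= k, forall w, `|B w| <= k * `|w| & forall w, 'd h v0 (B w) = w].
Proof.
pose T : 'Hom((X * R^o)%type, W) := linfun ('d h v0 : (X * R^o)%type -> W).
pose B : {linear W -> (X * R)%type} := (T^-1)%VF.
have [k k0 Bk] := linear_bounded_span B (euclidean_bounded_span W).
exists B, k; split => // w; have [v vw] := h_surj w.
have wT : w \in limg T.
  rewrite -vw -[X in X \in _](lfunE ('d h v0 : {linear (X * R^o)%type -> W})).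
  by rewrite memv_img ?memvf.
by have := limg_lfunVK wT; rewrite lfunE.
Qed.

Lemma reducible_regularity : exists (r k : R), [/\ 0 < r, 0 <= k &
  forall v w, `|v - v0| < r -> `|w| < r ->
    exists2 v', h v' = h v + w & `|v' - v| <= k * `|w|].
Proof.
have [B [k [k0 Bk TB]]] := reducible_right_inverse.
have [r r0 hr] := Graves k0 Bk TB (fun e => reducible_strict Ov0 (e := e)).
by exists r, (4 * k); split; rewrite // mulr_ge0.
Qed.

(** One radius serves all subgradients. The condition on [d] covers two uses: [d] in the kernel of
    the derivative, and, at [v0], [d] sent into [C]. *)
Lemma subgrad_kernel : exists2 r : R, 0 < r & forall z x a,
  fin_subgrad f z x a -> `|(z, a) - v0| < r -> O (z, a) /\
  forall d, (forall t : R, 0 < t -> t <= 1 -> C (h (z, a) + t *: 'd h (z, a) d)) ->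
    normal_fun x d <= 0.
Proof.
have [r [k [r0 k0 hr]]] := reducible_regularity.
have /near_normP[s s0 hs] : \forall x \near v0, O x by apply: open_nbhs_nbhs.
exists (Num.min r s); first by rewrite lt_min r0.
move=> z x a hx; rewrite lt_min => /andP[zr zs].
have Ov : O (z, a) by exact: hs.
split => // d hd.
apply: (normal_tangent (xi := normal_fun x) (m := `|x| + 1) r0 k0 hr oO epiE _ _ _ zr Ov _ hd).
- by rewrite addr_ge0.
- exact: normal_fun_bound.
- by move=> v' /normal_fun_le0; apply.
- by move=> e; exact: reducible_strict0.
Qed.

Lemma subgrad_factor : exists2 r : R, 0 < r & forall z x a,
  fin_subgrad f z x a -> `|(z, a) - v0| < r ->
  exists y, forall d, normal_fun x d = inner y ('d h (z, a) d).
Proof.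
have [r r0 hr] := subgrad_kernel; exists r => // z x a hx zr.
have [Ov hd] := hr _ _ _ hx zr.
have Chz : C (h (z, a)).
  suff : [set v | O v /\ C (h v)] (z, a) by case.
  by rewrite -epiE; split => //; rewrite /epi /= hx.1.
pose T : 'Hom((X * R^o)%type, W) := linfun ('d h (z, a) : (X * R^o)%type -> W).
pose xi : 'Hom((X * R^o)%type, R^o) := linfun (normal_fun x : (X * R^o)%type -> R^o).
have TE d : T d = 'd h (z, a) d by exact: (lfunE ('d h (z, a) : {linear (X * R^o)%type -> W})).
have xiE d : xi d = normal_fun x d.
  by exact: (lfunE (normal_fun x : {linear (X * R^o)%type -> R^o})).
have [d Td|y hy] := @linear_factor R _ W T xi; last first.
  by exists y => d; rewrite -xiE hy TE.
(* On the kernel, both [d] and [- d] are admissible directions. *)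
rewrite xiE; apply/le_anti/andP; rewrite TE in Td; split.
  by apply: hd => t _ _; rewrite Td scaler0 addr0.
rewrite -oppr_le0 -(linearN (normal_fun x)).
by apply: hd => t _ _; rewrite linearN /= Td oppr0 scaler0 addr0.
Qed.

Lemma subgrad_polar x : fin_subgrad f zbar x abar ->
  exists2 y, polar C y & forall d, normal_fun x d = inner y ('d h v0 d).
Proof.
move=> hx; have [r r0 hr] := subgrad_kernel; have [s s0 hs] := subgrad_factor.
have vv (e : R) : 0 < e -> `|(zbar, abar) - v0| < e by rewrite subrr normr0.
have [y hy] := hs _ _ _ hx (vv _ s0); exists y => // w Cw.
have [d dw] := h_surj w; rewrite -dw -hy.
apply: (hr _ _ _ hx (vv _ r0)).2 => t t0 t1.
rewrite -/v0 h0 add0r dw; have [_ _ kC _] := C_cone; apply: kC => //; exact: ltW.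
Qed.

(** The expansion of [h] gives this only to first order at [v0]; convexity of the epigraph makes it
    global, since [v0 + t *: (v - v0)] stays in [epi f] for small [t]. *)
Lemma polar_normal y v : polar C y -> epi f v -> inner y ('d h v0 (v - v0)) <= 0.
Proof.
move=> Py fv; rewrite leNgt; apply/negP; set u := v - v0 => yu.
have m0 : 0 < (`|y| + 1) * (`|u| + 1) by rewrite mulr_gt0// ltr_wpDl.
pose e := inner y ('d h v0 u) / (2 * ((`|y| + 1) * (`|u| + 1))).
have e0 : 0 < e by rewrite divr_gt0// mulr_gt0.
have eE : e * (2 * ((`|y| + 1) * (`|u| + 1))) = inner y ('d h v0 u).
  by rewrite divfK// gt_eqF// mulr_gt0.
have [d d0 hd] := reducible_strict0 Ov0 e0.
have /near_normP[s s0 hs] : \forall x \near v0, O x by apply: open_nbhs_nbhs.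
pose t := Num.min 1 (Num.min d s / (2 * (`|u| + 1))).
have u1 : 0 < `|u| + 1 by rewrite ltr_wpDl.
have ds0 : 0 < Num.min d s by rewrite lt_min d0.
have t0 : 0 < t by rewrite lt_min ltr01 divr_gt0// mulr_gt0.
have t1 : t <= 1 by rewrite ge_min lexx.
have tE : t * (2 * (`|u| + 1)) <= Num.min d s.
  by rewrite -ler_pdivlMr ?mulr_gt0// /t ge_min lexx orbT.
have tu : t * `|u| < Num.min d s by have := mulr_ge0 (ltW t0) (normr_ge0 u); lra.
rewrite -[X in X * `|u|]gtr0_norm// -normrZ lt_min in tu.
have /andP[tud tus] := tu.
have Cv : C (h (v0 + t *: u)).
  suff : [set v | O v /\ C (h v)] (v0 + t *: u) by case.
  rewrite -epiE; split; last by apply: hs; rewrite addrAC subrr add0r.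
  have fz' : (f zbar <= abar%:E)%E by rewrite fz.
  have := convex_fun_le f_convex (ltW t0) t1 fv fz'.
  rewrite /epi /=.
  have -> : t *: v.1 + (1 - t) *: zbar = zbar + t *: (v.1 - zbar) by rewrite convex_combE.
  suff -> : t * v.2 + (1 - t) * abar = abar + t *: (v.2 - abar) by [].
  rewrite -[_ *: _]/(t * _); ring.
have := Py _ Cv; have := hd _ tud; rewrite h0 subr0 linearZ /= normrZ gtr0_norm//.
set q := h _ - _ => qE.
have -> : h (v0 + t *: u) = q + t *: 'd h v0 u by rewrite /q subrK.
rewrite innerDr innerZr => h1.
have h2 : - (`|y| * (e * (t * `|u|))) <= inner y q.
  rewrite lerNl -innerNr (le_trans (inner_CauchySchwarz _ _))// normrN.
  by rewrite ler_wpM2l.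
have : t * (inner y ('d h v0 u) - `|y| * e * `|u|) <= 0 by lra.
rewrite pmulr_rle0// -eE.
have := mulr_gt0 e0 m0; have := mulr_ge0 (ltW e0) (normr_ge0 u).
have := mulr_ge0 (ltW e0) (normr_ge0 y).
have := mulr_ge0 (mulr_ge0 (normr_ge0 y) (ltW e0)) (normr_ge0 u).
lra.
Qed.

(** The functional [d |-> inner u d.1] has a multiplier, split as a difference p - q of polar
    vectors. Adding [e *: p] or [e *: q] to the multiplier of [xbar] gives two epigraph normals
    whose horizontal parts differ by [e *: u]. *)
Lemma kernel_orthogonal_par xbar u : fin_subgrad f zbar xbar abar ->
  proper_fun f ->
  (forall d, 'd h v0 d = 0 -> inner u d.1 = 0) -> par (subdifferential f zbar) u.
Proof.
move=> hx pf hu; have [ybar Pybar ybarE] := subgrad_polar hx.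
pose T : 'Hom((X * R^o)%type, W) := linfun ('d h v0 : (X * R^o)%type -> W).
have TE d : T d = 'd h v0 d by exact: (lfunE ('d h v0 : {linear (X * R^o)%type -> W})).
have inner_lin (w : X) : linear (fun d : (X * R)%type => inner w d.1 : R^o).
  by move=> a d d' /=; rewrite innerDr innerZr.
pose xi0 : {linear (X * R^o)%type -> R^o} := HB.pack
  (fun d : (X * R)%type => inner u d.1 : R^o) (GRing.isLinear.Build _ _ _ _ _ (inner_lin u)).
have [d Td|y hy] := @linear_factor R _ W T (linfun xi0).
  by rewrite lfunE /= hu// -TE.
have yE d : inner u d.1 = inner y ('d h v0 d) by rewrite -TE -hy lfunE.
have [p [q [Pp Pq ypq]]] := polar_generating y C_cone.
have qlin : linear (fun w : X => inner q ('d h v0 (w, 0)) : R^o).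
  move=> a w w'; rewrite -[a *: inner q _]/(a * inner q _) -innerZr -innerDr; congr inner.
  rewrite -linearZ -linearD; congr ('d h v0 _).
  by apply/pair_equal_spec; rewrite /= scaler0 addr0.
pose Q : {linear X -> R^o} := HB.pack (fun w : X => inner q ('d h v0 (w, 0)) : R^o)
  (GRing.isLinear.Build _ _ _ _ _ qlin).
have [a aE] := inner_riesz (linfun Q).
(* The multipliers [p] and [q] have the same vertical part [- s], because their difference pairs
   only with [d.1]. So both perturbed normals are rescaled by the same [tau], which the choice of
   [e] keeps positive. *)
pose s := - inner q ('d h v0 (0, 1)).
have qE d : inner q ('d h v0 d) = inner a d.1 - s * d.2.
  have -> : d = (d.1, 0) + d.2 *: (0, 1).
    by case: d => d1 d2; apply/pair_equal_spec; rewrite /= scaler0 addr0 add0r [_ *: _]mulr1.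
  rewrite linearD linearZ innerDr innerZr /= -aE lfunE /= scaler0 addr0 add0r /s.
  by rewrite [_ *: 1]mulr1; ring.
pose e := (2 * (`|s| + 1))^-1.
have e0 : 0 < e by rewrite invr_gt0 mulr_gt0// ltr_wpDl.
have eE : e * (2 * (`|s| + 1)) = 1 by rewrite mulVf// gt_eqF// mulr_gt0// ltr_wpDl.
pose tau := 1 + e * s.
have tau0 : 0 < tau.
  have := ler_norm (- s); rewrite normrN /tau => sN.
  have := ler_wpM2l (ltW e0) sN; lra.
have sub w r : polar C r -> (forall d, inner r ('d h v0 d) = inner w d.1 - tau * d.2) ->
    subdifferential f zbar (tau^-1 *: w).
  move=> Pr rE; apply/(fin_subgradP _ _ pf); exists abar; split => // z b fzb.
  have := @polar_normal r (z, b) Pr fzb; rewrite rE /= innerZl => hh.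
  have : tau * (abar + tau^-1 * inner w (z - zbar)) <= tau * b.
    by rewrite mulrDr mulrA divff ?gt_eqF// mul1r; lra.
  by rewrite ler_pM2l.
have D1 : subdifferential f zbar (tau^-1 *: (xbar + e *: a)).
  apply: (sub _ (ybar + e *: q)).
    move=> w Cw; rewrite innerDl innerZl; have := Pybar w Cw; have := Pq w Cw; nra.
  move=> d; rewrite innerDl innerZl -ybarE qE /normal_fun innerDl innerZl /tau; ring.
have D2 : subdifferential f zbar (tau^-1 *: (xbar + e *: a + e *: u)).
  apply: (sub _ (ybar + e *: p)).
    move=> w Cw; rewrite innerDl innerZl; have := Pybar w Cw; have := Pp w Cw; nra.
  have -> : p = y + q by rewrite ypq subrK.
  move=> d; rewrite innerDl innerZl innerDl -ybarE -yE qE.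
  rewrite /normal_fun !innerDl !innerZl /tau; ring.
exists (tau^-1 *: (xbar + e *: a)) => //.
pose w := (tau^-1 * e) *: u.
exists [:: w].
  move=> x; rewrite inE => /eqP ->; eexists; first exact: D2.
  by rewrite -scalerBr addrAC subrr add0r scalerA.
rewrite span_seq1; have -> : u = (tau^-1 * e)^-1 *: w.
  by rewrite scalerA mulVf ?scale1r// gt_eqF// mulr_gt0// invr_gt0.
by rewrite memvZ// memv_line.
Qed.

End reducible_epigraph.

(** * Quantitative comparison of subgradients at nearby points *)

Lemma le_of_sqr_le (R : realFieldType) (s a : R) :
  0 <= s -> 0 <= a -> s ^+ 2 <= a * s + 2^-1 * s ^+ 2 -> s <= 2 * a.
Proof.
move=> s0 a0 h; have [-> |sn0] := eqVneq s 0; first by rewrite mulr_ge0.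
have sgt0 : 0 < s by rewrite lt_neqAle eq_sym sn0.
by rewrite -(ler_pM2r sgt0); lra.
Qed.

Lemma subgrad_value_Lipschitz (R : realType) (X : euclideanType R)
    (f : X -> \bar R) z1 x1 a1 z2 x2 a2 (m : R) :
  fin_subgrad f z1 x1 a1 -> fin_subgrad f z2 x2 a2 ->
  `|x1| <= m -> `|x2| <= m -> `|a1 - a2| <= m * `|z1 - z2|.
Proof.
move=> [f1 h1] [f2 h2] x1m x2m.
have := h1 z2 a2; have := h2 z1 a1; rewrite f1 f2 !lexx => /(_ isT) + /(_ isT).
have : - inner x1 (z2 - z1) <= m * `|z1 - z2|.
  by rewrite -innerNr opprB (le_trans (inner_CauchySchwarz _ _))// ler_wpM2r.
have : - inner x2 (z1 - z2) <= m * `|z1 - z2|.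
  by rewrite -innerNl (le_trans (inner_CauchySchwarz _ _))// normrN ler_wpM2r.
by rewrite ler_norml => *; apply/andP; split; lra.
Qed.

(** [phi] is a continuous seminorm that vanishes only at 0, so it has a positive minimum on the
    compact unit sphere; an empty sphere means that [X] is trivial. *)
Lemma injective_coercive (R : realType) (X Y : euclideanType R)
    (A : 'Hom(X, Y)) n (d : 'I_n -> X) :
  (forall u, A u = 0 -> (forall j, inner u (d j) = 0) -> u = 0) ->
  exists2 c : R, 0 < c & forall u, `|u| <= c * (`|A u| + \sum_j `|inner u (d j)|).
Proof.
move=> inj; pose K := [set u : X | `|u - 0| = 1].
pose phi u : R := `|A u| + \sum_j `|inner u (d j)|.
have normK u : u != 0 -> K (`|u|^-1 *: u).
  move=> u0; rewrite /K /= subr0 normrZ normfV normr_id mulVf//.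
  by rewrite normr_eq0.
have phi0 u : 0 <= phi u by rewrite addr_ge0// sumr_ge0.
have phiZ (t : R) u : phi (t *: u) = `|t| * phi u.
  rewrite /phi linearZ normrZ mulrDr mulr_sumr; congr (_ + _).
  by apply: eq_bigr => j _; rewrite innerZl normrM.
have [K0|/set0P K0] := eqVneq K set0.
  exists 1 => // u; have [->|/normK] := eqVneq u 0; last by rewrite K0.
  by rewrite normr0 mul1r phi0.
have [||u Ku umin] := @Lipschitz_compact_min _ _ K phi
    (opnorm A + \sum_j `|d j|) (@sphere_compact _ _ _ _).
- exact: K0.
- move=> x y _ _; rewrite /phi opprD addrACA mulrDl.
  rewrite (le_trans (ler_normD _ _))// lerD//.
    by rewrite (le_trans (ler_dist_dist _ _))// -linearB le_opnorm.
  rewrite -sumrB mulr_suml (le_trans (ler_norm_sum _ _ _))// ler_sum// => j _.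
  by rewrite (le_trans (ler_dist_dist _ _))// -innerBl mulrC ler_norm_inner.
have phiu : 0 < phi u.
  rewrite lt_neqAle phi0 andbT; apply/eqP => /esym/eqP.
  rewrite paddr_eq0 ?sumr_ge0// normr_eq0 psumr_eq0// => /andP[/eqP Au /allP hu].
  have u0 : u = 0.
    apply: inj => // j; have := hu j; rewrite mem_index_enum normr_eq0.
    by move=> /(_ isT)/eqP.
  by move: Ku; rewrite /K /= u0 subrr normr0 => /esym/eqP; rewrite oner_eq0.
exists (phi u)^-1; first by rewrite invr_gt0.
have i0 : 0 <= (phi u)^-1 by rewrite invr_ge0 ltW.
move=> v; have [->|v0] := eqVneq v 0.
  by rewrite normr0 (mulr_ge0 i0 (phi0 0)).
have := umin _ (normK _ v0); rewrite phiZ normfV normr_id.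
by rewrite ler_pdivlMl ?normr_gt0// -/(phi v) ler_pdivlMl// mulrC.
Qed.

(* The functionals [xi_i = y_i o H_i] have multipliers [y_i] controlled by
   composing with a right inverse [B] of [H0]. *)
Lemma multiplier_variation (R : realType) (V : normedModType R)
    (W : euclideanType R) (H0 H1 H2 : V -> W) (B : W -> V) (xi1 xi2 : V -> R)
    (y1 y2 : W) (b del l m n : R) :
  0 <= b -> 0 <= del -> 0 <= l -> 0 <= m -> 0 <= n -> del * b <= 2^-1 ->
  (forall w, `|B w| <= b * `|w|) -> (forall w, H0 (B w) = w) ->
  (forall u, `|H0 u - H1 u| <= del * `|u|) ->
  (forall u, `|H0 u - H2 u| <= del * `|u|) ->
  (forall u, `|H1 u - H2 u| <= l * `|u|) ->
  (forall u, xi1 u = inner y1 (H1 u)) -> (forall u, xi2 u = inner y2 (H2 u)) ->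
  (forall u, `|xi2 u| <= m * `|u|) ->
  (forall u, `|xi1 u - xi2 u| <= n * `|u|) ->
  forall d, H0 d = 0 ->
    `|xi1 d - xi2 d| <= (2 * del * b * (n + 2 * m * b * l) + 2 * m * b * l) * `|d|.
Proof.
move=> b0 del0 l0 m0 n0 db Bb HB H01 H02 H12 xi1E xi2E xi2m xi12 d Hd.
have half H w : (forall u, `|H0 u - H u| <= del * `|u|) ->
    `|H0 (B w) - H (B w)| <= 2^-1 * `|w|.
  move=> hH; rewrite (le_trans (hH _))// (le_trans (ler_wpM2l del0 (Bb w)))//.
  by rewrite mulrA ler_wpM2r.
have yE xi y H w : (forall u, xi u = inner y (H u)) ->
    inner y w = xi (B w) + inner y (H0 (B w) - H (B w)).
  by move=> xiE; rewrite xiE innerBr HB addrCA subrr addr0.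
(* The multiplier is tested on itself: |y2|^2 is [xi2 (B y2)] plus an error of at most half of
   |y2|^2, which is absorbed. The difference y1 - y2 is treated in the same way below. *)
have y2b : `|y2| <= 2 * (m * b).
  apply: le_of_sqr_le; rewrite ?mulr_ge0//.
  rewrite normr_inner {1}(yE _ _ _ y2 xi2E) -normr_inner lerD//.
    rewrite (le_trans (ler_norm _))// (le_trans (xi2m _))//.
    by rewrite -mulrA ler_wpM2l.
  rewrite (le_trans (inner_CauchySchwarz _ _))// expr2 mulrCA ler_wpM2l//.
  exact: half.
set y := y1 - y2.
have yb : `|y| <= 2 * (n * b + 2 * (m * b) * (l * b)).
  apply: le_of_sqr_le; rewrite ?addr_ge0 ?mulr_ge0//.
  have yy : `|y| ^+ 2 = (xi1 (B y) - xi2 (B y)) +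
      inner y2 (H2 (B y) - H1 (B y)) + inner y (H0 (B y) - H1 (B y)).
    rewrite normr_inner {1}/y innerBl (yE _ _ _ y xi1E) (yE _ _ _ y xi2E).
    rewrite [inner y (_ - _)]innerBl !innerBr; ring.
  rewrite [leLHS]yy lerD//; last first.
    rewrite (le_trans (inner_CauchySchwarz _ _))// expr2 mulrCA ler_wpM2l//.
    exact: half.
  rewrite mulrDl lerD//.
    rewrite (le_trans (ler_norm _))// (le_trans (xi12 _))//.
    by rewrite -mulrA ler_wpM2l.
  rewrite (le_trans (inner_CauchySchwarz _ _))// -[leRHS]mulrA ler_pM//.
  by rewrite distrC (le_trans (H12 _))// -mulrA ler_wpM2l.
have H1d : `|H1 d| <= del * `|d| by have := H01 d; rewrite Hd sub0r normrN.
have -> : xi1 d - xi2 d = inner y (H1 d) + inner y2 (H1 d - H2 d).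
  by rewrite xi1E xi2E /y innerBl innerBr addrA subrK.
rewrite (le_trans (ler_normD _ _))// mulrDl lerD//.
  rewrite (le_trans (ler_norm_inner _ _))// (le_trans (ler_pM _ _ yb H1d))//.
  by rewrite le_eqVlt; apply/orP; left; apply/eqP; ring.
rewrite (le_trans (ler_norm_inner _ _))// (le_trans (ler_pM _ _ y2b (H12 d)))//.
by rewrite le_eqVlt; apply/orP; left; apply/eqP; ring.
Qed.

Section subgradient_variation.
Context {R : realType} {X W : euclideanType R}.
Variables (f : X -> \bar R) (zbar : X) (abar : R).
Variables (O : set (X * R)) (C : set W) (h : X * R -> W).
Let v0 : X * R := (zbar, abar).
Hypotheses (f_convex : convex_fun f) (fz : f zbar = abar%:E).
Hypotheses (oO : open O) (Ov0 : O v0) (C_cone : pointed_closed_convex_cone C).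
Hypotheses (hC2 : C2_on O h) (h0 : h v0 = 0).
Hypothesis h_surj : forall w, exists v, 'd h v0 v = w.
Hypothesis epiE : epi f `&` O = [set v | O v /\ C (h v)].

Lemma subgrad_variation xbar (m e : R) : fin_subgrad f zbar xbar abar ->
  `|xbar| <= m -> 0 < e ->
  exists (r k : R), [/\ 0 < r, 0 <= k & forall z1 x1 a1 z2 x2 a2,
    fin_subgrad f z1 x1 a1 -> fin_subgrad f z2 x2 a2 ->
    `|x1| <= m -> `|x2| <= m -> `|z1 - zbar| < r -> `|z2 - zbar| < r ->
    forall d, 'd h v0 d = 0 ->
      `|inner (x1 - x2) d.1| <= (e * `|x1 - x2| + k * `|z1 - z2|) * `|d|].
Proof.
move=> hx xm e0.
have [B [b [b0 Bb TB]]] := reducible_right_inverse h_surj; rewrite -/v0 in TB.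
have bXR : bounded_span (X * R)%type by exact/bounded_span_prod/euclidean_bounded_span.
have [s [l [s0 l0 hl]]] := differential_Lipschitz bXR oO Ov0 hC2.
have [t t0 ht] := subgrad_factor oO Ov0 hC2 h_surj epiE.
have m0 : 0 <= m by exact: le_trans xm.
have l1 : 0 < l + 1 by rewrite ltr_wpDl.
have b1 : 0 < b + 1 by rewrite ltr_wpDl.
have m1 : 0 < m + 1 by rewrite ltr_wpDl.
(* [l * q] will bound the variation of the derivative: l b q <= 1/2 is needed for absorption, and 2
   l b q <= e makes the coefficient of |x1 - x2| at most [e]. *)
pose q := Num.min 1 e / (2 * (l + 1) * (b + 1)).
have mine0 : 0 < Num.min 1 e by rewrite lt_min ltr01.
have q0 : 0 < q by rewrite divr_gt0// !mulr_gt0.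
have lbq : l * b * q <= Num.min 1 e / 2.
  have : q * (2 * (l + 1) * (b + 1)) = Num.min 1 e.
    by rewrite divfK// gt_eqF// !mulr_gt0.
  have := mulr_ge0 (ltW q0) l0; have := mulr_ge0 (ltW q0) b0; lra.
have lbq1 : l * b * q <= 2^-1.
  by rewrite (le_trans lbq)// ler_pdivrMr// mulVf ?pnatr_eq0// ge_min lexx.
have lbqe : 2 * (l * b * q) <= e.
  have : Num.min 1 e <= e by rewrite ge_min lexx orbT.
  lra.
clearbody q; clear lbq mine0.
(* The divisor m + 1 converts a distance between points z into one between points (z, f z). *)
pose r := Num.min q (Num.min s t) / (m + 1).
have r0 : 0 < r by rewrite divr_gt0// !lt_min q0 s0.
pose k := 4 * (m + 1) * b * l * (m + 1).
exists r, k; split => //; first by rewrite !mulr_ge0// ltW.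
move=> z1 x1 a1 z2 x2 a2 h1 h2 x1m x2m z1r z2r d kd.
have dist z x a z' x' a' : fin_subgrad f z x a -> fin_subgrad f z' x' a' ->
    `|x| <= m -> `|x'| <= m -> `|(z, a) - (z', a')| <= (m + 1) * `|z - z'|.
  move=> hz hz' xm' xm''; rewrite prod_normE /= ge_max mulrDl mul1r lerDr.
  rewrite mulr_ge0//= (le_trans (subgrad_value_Lipschitz hz hz' xm' xm''))//.
  by rewrite lerDl.
have near z x a : fin_subgrad f z x a -> `|x| <= m -> `|z - zbar| < r ->
    [/\ `|(z, a) - v0| < q, `|(z, a) - v0| < s & `|(z, a) - v0| < t].
  move=> hz xm' zr; have := dist _ _ _ _ _ _ hz hx xm' xm => hd.
  have : `|(z, a) - v0| < Num.min q (Num.min s t).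
    rewrite (le_lt_trans hd)//; move: zr; rewrite /r ltr_pdivlMr// mulrC.
    by [].
  by rewrite !lt_min => /and3P[].
set v1 : X * R := (z1, a1); set v2 : X * R := (z2, a2).
have [v1q v1s v1t] := near _ _ _ h1 x1m z1r.
have [v2q v2s v2t] := near _ _ _ h2 x2m z2r.
have [y1 y1E] := ht _ _ _ h1 v1t; have [y2 y2E] := ht _ _ _ h2 v2t.
rewrite -/v1 in y1E v1q v1s; rewrite -/v2 in y2E v2q v2s.
have v0s : `|v0 - v0| < s by rewrite subrr normr0.
have Hd v u : `|v - v0| < q -> `|v - v0| < s -> `|'d h v0 u - 'd h v u| <= l * q * `|u|.
  move=> vq vs; rewrite (le_trans (hl _ _ v0s vs u))// ler_wpM2r// ler_wpM2l//.
  by rewrite distrC ltW.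
pose D := `|v1 - v2|.
have D0 : 0 <= D by exact: normr_ge0.
have DE : D <= (m + 1) * `|z1 - z2| by exact: dist h1 h2 _ _.
set x := x1 - x2.
have x12 (u : X * R) : normal_fun x1 u - normal_fun x2 u = inner x u.1.
  by rewrite /normal_fun /x innerBl opprB addrA subrK.
have : `|normal_fun x1 d - normal_fun x2 d| <= (2 * (l * q) * b *
    (`|x| + 2 * (m + 1) * b * (l * D)) + 2 * (m + 1) * b * (l * D)) * `|d|.
  apply: (multiplier_variation b0 _ _ _ _ _ Bb TB _ _ _ y1E y2E _ _ kd).
  - by rewrite mulr_ge0// ltW.
  - by rewrite mulr_ge0.
  - exact: ltW.
  - exact: normr_ge0.
  - by rewrite mulrAC.
  - by move=> u; apply: Hd.
  - by move=> u; apply: Hd.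
  - by move=> u; apply: hl.
  - move=> u; rewrite (le_trans (normal_fun_bound _ _))// ler_wpM2r//.
    by rewrite lerD2r.
  - move=> u; rewrite x12 (le_trans (ler_norm_inner _ _))// ler_wpM2l//.
    by rewrite [leRHS]prod_normE le_max lexx.
rewrite x12 => /le_trans; apply; rewrite ler_wpM2r//.
have e3 : 2 * (l * b * q) * `|x| <= e * `|x| by rewrite ler_wpM2r.
have e4 : l * b * q * (4 * ((m + 1) * b * l * D)) <=
    2^-1 * (4 * ((m + 1) * b * l * D)).
  by rewrite ler_wpM2r// !mulr_ge0// ltW.
have e5 : 4 * ((m + 1) * b * l) * D <=
    4 * ((m + 1) * b * l) * ((m + 1) * `|z1 - z2|).
  by rewrite ler_wpM2l// !mulr_ge0// ltW.
have -> : k = 4 * ((m + 1) * b * l) * (m + 1) by rewrite /k; ring.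
clear -e3 e4 e5; lra.
Qed.

(** A vector orthogonal to the horizontal parts [(d j).1] of a kernel basis lies in the parallel
    subspace, so [inj] makes [A] and these pairings jointly injective; [subgrad_variation] bounds
    the pairings. *)
Lemma subgrad_coercive (Y : euclideanType R) (A : 'Hom(X, Y)) xbar (m : R) :
  proper_fun f -> fin_subgrad f zbar xbar abar -> `|xbar| <= m ->
  (forall u, A u = 0 -> par (subdifferential f zbar) u -> u = 0) ->
  exists (r c : R), [/\ 0 < r, 0 < c & forall z1 x1 a1 z2 x2 a2,
    fin_subgrad f z1 x1 a1 -> fin_subgrad f z2 x2 a2 ->
    `|x1| <= m -> `|x2| <= m -> `|z1 - zbar| < r -> `|z2 - zbar| < r ->
    `|x1 - x2| <= c * (`|A (x1 - x2)| + `|z1 - z2|)].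
Proof.
move=> pf hx xm inj.
pose T : 'Hom((X * R^o)%type, W) := linfun ('d h v0 : (X * R^o)%type -> W).
have TE d : T d = 'd h v0 d by exact: (lfunE ('d h v0 : {linear (X * R^o)%type -> W})).
pose n := \dim (lker T); pose d (j : 'I_n) : X * R := (vbasis (lker T))`_j.
have dk j : 'd h v0 (d j) = 0.
  rewrite -TE; apply/eqP; rewrite -memv_ker; apply: vbasis_mem.
  by rewrite mem_nth// size_tuple.
have [u Au ud|c c0 hc] := @injective_coercive _ _ _ A n (fun j => (d j).1).
  apply: inj => //; apply: (kernel_orthogonal_par f_convex fz oO Ov0 C_cone hC2 h0
    h_surj epiE hx pf).
  move=> v kv; have vk : v \in lker T by rewrite memv_ker TE kv.
  rewrite (coord_vbasis vk) (raddf_sum fst) inner_sumr big1// => j _.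
  by rewrite [X in inner u X](_ : _ = coord (vbasis (lker T)) j v *: (d j).1)//
    innerZr ud mulr0.
pose N := \sum_j `|d j|.
have N0 : 0 <= N by exact: sumr_ge0.
have N1 : 0 < N + 1 by rewrite ltr_wpDl.
(* Ensures c e N <= 1/2, so that |x1 - x2| can be absorbed on the left. *)
pose e := (2 * c * (N + 1))^-1.
have e0 : 0 < e by rewrite invr_gt0 !mulr_gt0.
have eE : e * (2 * c * (N + 1)) = 1 by rewrite mulVf// gt_eqF// !mulr_gt0.
have [r [k [r0 k0 hr]]] := subgrad_variation hx xm e0.
exists r, (2 * c * (1 + N * k)); split => //.
  by rewrite !mulr_gt0// ltr_wpDr// mulr_ge0.
move=> z1 x1 a1 z2 x2 a2 h1 h2 x1m x2m z1r z2r; set x := x1 - x2.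
have hN : \sum_j `|inner x (d j).1| <= (e * `|x| + k * `|z1 - z2|) * N.
  by rewrite /N mulr_sumr ler_sum// => j _; exact: hr h1 h2 x1m x2m z1r z2r _ (dk j).
have hx1 := hc x.
have h3 := ler_wpM2l (ltW c0) hN.
have h4 : c * e * N <= 2^-1.
  have : 0 < c * e by rewrite mulr_gt0.
  lra.
have h5 : c * e * N * `|x| <= 2^-1 * `|x| by rewrite ler_wpM2r.
have h6 : 0 <= c * N * k * `|A x| by rewrite !mulr_ge0// ltW.
have h7 : 0 <= c * `|z1 - z2| by rewrite !mulr_ge0// ltW.
clear -hx1 h3 h5 h6 h7; lra.
Qed.

End subgradient_variation.

(** * Stability of the solutions *)

Section adjoint_theory.
Context {R : realType} {X Y : euclideanType R}.
Implicit Types A B : 'Hom(X, Y).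

Lemma inner_inj (V : euclideanType R) (x y : V) :
  (forall w, inner w x = inner w y) -> x = y.
Proof.
move=> xy; apply/eqP; rewrite -subr_eq0; apply/eqP/inner_eq0.
by rewrite innerBr xy subrr.
Qed.

Lemma adjointB A B y : adjoint (A - B) y = adjoint A y - adjoint B y.
Proof.
by apply: inner_inj => w; rewrite innerBr -!adjointE add_lfunE opp_lfunE innerBl.
Qed.

Lemma le_adjoint A y : `|adjoint A y| <= `|A| * `|y|.
Proof.
have [->|n0] := eqVneq (adjoint A y) 0; first by rewrite normr0 mulr_ge0.
have np : 0 < `|adjoint A y| by rewrite normr_gt0.
rewrite -(ler_pM2l np) -expr2 normr_inner -adjointE.
rewrite (le_trans (inner_CauchySchwarz _ _))// mulrA ler_wpM2r//.
by rewrite mulrC le_opnorm.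
Qed.

Lemma le_lfun_norm A x : `|A x| <= `|A| * `|x|.
Proof. exact: le_opnorm. Qed.

End adjoint_theory.

Section conjugate_convexity.
Context {R : realType} {X : euclideanType R}.

Lemma fenchel_conj_convex (g : X -> \bar R) : proper_fun g ->
  convex_fun (fenchel_conj g).
Proof.
move=> pg [z a] [z' a'] t; rewrite !inE /epi /= => /(fenchel_conj_leP _ _ pg) hz.
move=> /(fenchel_conj_leP _ _ pg) hz'; apply/(fenchel_conj_leP _ _ pg) => x b gb.
have t0 : 0 <= t%:num by [].
have t1 : 0 <= unstable.onem t%:num by rewrite subr_ge0.
rewrite innerDl !innerZl.
have := ler_wpM2l t0 (hz x b gb); have := ler_wpM2l t1 (hz' x b gb).
rewrite -[t%:num *: a]/(t%:num * a) -[_ *: a']/(_ * a') /unstable.onem; lra.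
Qed.

Lemma fin_subgrad_convex (f : X -> \bar R) z a x y (t : R) : 0 <= t -> t <= 1 ->
  fin_subgrad f z x a -> fin_subgrad f z y a ->
  fin_subgrad f z (t *: x + (1 - t) *: y) a.
Proof.
move=> t0 t1 [fz hx] [_ hy]; split => // w b fw; rewrite innerDl !innerZl.
have := ler_wpM2l t0 (hx w b fw).
have : (1 - t) * (a + inner y (w - z)) <= (1 - t) * b.
  by rewrite ler_wpM2l ?subr_ge0// hy.
lra.
Qed.

(** The directions of segments centred at some point and contained in [D] form a subspace: after
    shrinking two segments to a common half-length, midpoints add their directions. It contains each
    y - x0, through the segment from [x0] to [y]. *)
Lemma par_segment (D : set X) u :
  (forall (t : R) x y, 0 <= t -> t <= 1 -> D x -> D y -> D (t *: x + (1 - t) *: y)) ->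
  par D u -> exists x e, [/\ 0 < e, D (x + e *: u) & D (x - e *: u)].
Proof.
move=> Dc [x0 Dx0 [s sD us]].
pose P u := exists x e, [/\ 0 < e, D (x + e *: u) & D (x - e *: u)].
have half x y : D x -> D y -> D (2^-1 *: (x + y)).
  move=> Dx Dy; have := Dc 2^-1 x y; rewrite scalerDr.
  have -> : 1 - 2^-1 = 2^-1 :> R by field.
  by apply => //; lra.
have halfK (x : X) : 2^-1 *: (x + x) = x.
  by rewrite scalerDr -scalerDl (_ : 2^-1 + 2^-1 = 1) ?scale1r//; field.
have PZ a v : P v -> P (a *: v).
  move=> [x [e [e0 D1 D2]]]; have [a0|a0|->] := ltgtP a 0.
  - exists x, (e / - a); split; first by rewrite divr_gt0// oppr_gt0.
      by rewrite scalerA invrN mulrN mulNr divfK ?lt_eqF// scaleNr.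
    by rewrite scalerA invrN mulrN mulNr divfK ?lt_eqF// scaleNr opprK.
  - exists x, (e / a); split; first by rewrite divr_gt0.
      by rewrite scalerA divfK ?gt_eqF.
    by rewrite scalerA divfK ?gt_eqF.
  - have := half _ _ D1 D2; rewrite addrACA subrr addr0 halfK => Dx.
    by exists x, 1; rewrite !scale0r scaler0 subr0 addr0.
have Pe v e e' x : 0 < e' -> e' <= e -> D (x + e *: v) -> D (x - e *: v) ->
    D (x + e' *: v).
  move=> e'0 e'e D1 D2; have e0 : 0 < e by exact: lt_le_trans e'e.
  pose t := (1 + e' / e) / 2.
  have r1 : e' / e <= 1 by rewrite ler_pdivrMr// mul1r.
  have r0 : 0 < e' / e by rewrite divr_gt0.
  have := Dc t _ _ _ _ D1 D2.
  rewrite convex_combE opprD addrACA subrr add0r opprK -scalerDl scalerA.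
  rewrite -addrA -scaleNr -scalerDl.
  have -> : - e + t * (e + e) = e' by rewrite /t; field; rewrite gt_eqF.
  by apply; rewrite /t; lra.
have PD v w : P v -> P w -> P (v + w).
  move=> [x [e [e0 D1 D2]]] [y [e' [e'0 D3 D4]]].
  pose m := Num.min e e'; have m0 : 0 < m by rewrite lt_min e0.
  have me : m <= e by rewrite ge_min lexx.
  have me' : m <= e' by rewrite ge_min lexx orbT.
  have midE v' w' : 2^-1 *: (x + m *: v' + (y + m *: w')) =
      2^-1 *: (x + y) + (m / 2) *: (v' + w').
    by rewrite [m / 2]mulrC -scalerA -scalerDr [in RHS](scalerDr m) addrACA.
  exists (2^-1 *: (x + y)), (m / 2); split; first by rewrite divr_gt0.
    by rewrite -midE; apply: half; [exact: Pe D1 D2|exact: Pe D3 D4].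
  rewrite -scalerN opprD -midE; apply: half.
    by apply: (Pe _ _ _ _ m0 me); rewrite scalerN ?opprK.
  by apply: (Pe _ _ _ _ m0 me'); rewrite scalerN ?opprK.
suff : P u by [].
rewrite (coord_span (X := in_tuple s) us).
elim/big_ind : _ => [|v w Pv Pw|i _].
- by exists x0, 1; rewrite scaler0 addr0 subr0.
- exact: PD.
- apply: PZ; have [y Dy <-] : [set y - x0 | y in D] (in_tuple s)`_i.
    by apply: sD; exact: mem_nth.
  exists (2^-1 *: (x0 + y)), 2^-1; split; first by rewrite invr_gt0.
    by rewrite -scalerDr [x0 + y]addrC addrACA subrr addr0 halfK.
  by rewrite -scalerBr opprB addrACA subrr addr0 halfK.
Qed.

End conjugate_convexity.

Section solution_stability.
Context {R : realType} {X Y : euclideanType R}.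
Implicit Types p : 'Hom(X, Y) * Y * R.

Definition dual_point p (x : X) : X :=
  p.2^-1 *: adjoint p.1.1 (p.1.2 - p.1.1 x).

Lemma dual_pointB p x1 x2 : dual_point p x1 - dual_point p x2 =
  - (p.2^-1 *: adjoint p.1.1 (p.1.1 (x1 - x2))).
Proof.
rewrite /dual_point -scalerBr -linearB /= opprB addrC addrA subrK.
by rewrite -(opprB (p.1.1 x1)) -linearB linearN scalerN.
Qed.

Lemma param_norm p : [/\ `|p.1.1| <= `|p|, `|p.1.2| <= `|p| & `|p.2| <= `|p|].
Proof.
by rewrite !prod_normE !le_max !lexx ?orbT; split.
Qed.

Variable pbar : 'Hom(X, Y) * Y * R.
Hypothesis mu_gt0 : 0 < pbar.2.

Let near_radius := Num.min 1 (pbar.2 / 2).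

Lemma near_radius_gt0 : 0 < near_radius.
Proof. by rewrite lt_min ltr01 divr_gt0. Qed.

Lemma near_param p : `|p - pbar| < near_radius ->
  [/\ `|p.1.1| <= `|pbar| + 1, `|p.1.2| <= `|pbar| + 1,
      pbar.2 / 2 < p.2 & p.2 < 2 * pbar.2].
Proof.
rewrite lt_min => /andP[p1 p2].
have pp : `|p| <= `|pbar| + 1.
  by rewrite -[p](subrK pbar) (le_trans (ler_normD _ _))// addrC lerD2l ltW.
have [n1 n2 _] := param_norm p; have [_ _ n3] := param_norm (p - pbar).
have : `|p.2 - pbar.2| < pbar.2 / 2 by exact: le_lt_trans p2.
rewrite ltr_norml => /andP[? ?].
by split; [exact: le_trans n1 pp|exact: le_trans n2 pp|lra|lra].
Qed.

Lemma inv_param_le p : `|p - pbar| < near_radius -> 0 < p.2^-1 <= 2 / pbar.2.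
Proof.
move=> /near_param[_ _ h1 h2]; have p0 : 0 < p.2 by apply: lt_trans h1; rewrite divr_gt0.
by rewrite invr_gt0 p0 /= -[2 / _]invf_div lef_pV2 ?posrE ?divr_gt0// ltW.
Qed.

Lemma inv_param_Lipschitz p1 p2 :
  `|p1 - pbar| < near_radius -> `|p2 - pbar| < near_radius ->
  `|p1.2^-1 - p2.2^-1| <= (2 / pbar.2) ^+ 2 * `|p1 - p2|.
Proof.
move=> h1 h2; have /andP[i1 j1] := inv_param_le h1; have /andP[i2 j2] := inv_param_le h2.
have -> : p1.2^-1 - p2.2^-1 = p1.2^-1 * p2.2^-1 * (p2.2 - p1.2).
  by field; rewrite !gt_eqF// -invr_gt0.
rewrite normrM [`|_ * _|]gtr0_norm ?mulr_gt0// expr2 ler_pM//.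
- by rewrite mulr_ge0// ltW.
- by rewrite ler_pM// ltW.
- by rewrite distrC; have [] := param_norm (p1 - p2).
Qed.

Lemma residual_le p x (m : R) : `|p - pbar| < near_radius -> `|x| <= m ->
  `|p.1.2 - p.1.1 x| <= (`|pbar| + 1) * (m + 1).
Proof.
move=> /near_param[h1 h2 _ _] xm; rewrite (le_trans (ler_normB _ _))//.
rewrite addrC mulrDr mulr1 lerD// (le_trans (le_lfun_norm _ _))//.
by rewrite ler_pM.
Qed.

Lemma residual_Lipschitz p1 p2 x (m : R) : `|x| <= m ->
  `|(p1.1.2 - p1.1.1 x) - (p2.1.2 - p2.1.1 x)| <= `|p1 - p2| * (m + 1).
Proof.
move=> xm; have -> : p1.1.2 - p1.1.1 x - (p2.1.2 - p2.1.1 x) =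
    (p1.1.2 - p2.1.2) - (p1.1.1 x - p2.1.1 x).
  by rewrite [in LHS]opprD [in RHS]opprD addrACA.
have [n1 n2 _] := param_norm (p1 - p2).
rewrite (le_trans (ler_normB _ _))// addrC mulrDr mulr1 lerD//.
have -> : p1.1.1 x - p2.1.1 x = (p1 - p2).1.1 x by rewrite add_lfunE opp_lfunE.
by rewrite (le_trans (le_lfun_norm _ _))// ler_pM.
Qed.

Lemma dual_point_Lipschitz (m : R) : 0 <= m -> exists2 k : R, 0 < k &
  forall p1 p2 x, `|p1 - pbar| < near_radius -> `|p2 - pbar| < near_radius ->
  `|x| <= m -> `|dual_point p1 x - dual_point p2 x| <= k * `|p1 - p2|.
Proof.
move=> m0; pose a := `|pbar| + 1; pose b := a * (m + 1); pose c := 2 / pbar.2.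
have a0 : 0 < a by rewrite ltr_wpDl.
have m1 : 0 < m + 1 by rewrite ltr_wpDl.
have b0 : 0 < b by rewrite mulr_gt0.
have c0 : 0 < c by rewrite divr_gt0.
exists (c ^+ 2 * (a * b) + c * b + c * (a * (m + 1))).
  have c2 : 0 < c ^+ 2 by rewrite exprn_gt0.
  exact: (addr_gt0 (addr_gt0 (mulr_gt0 c2 (mulr_gt0 a0 b0)) (mulr_gt0 c0 b0))
    (mulr_gt0 c0 (mulr_gt0 a0 m1))).
move=> p1 p2 x h1 h2 xm; rewrite /dual_point.
set r1 := p1.1.2 - _; set r2 := p2.1.2 - _.
have [A1a _ _ _] := near_param h1; have [A2a _ _ _] := near_param h2.
have /andP[/ltW i1 j1] := inv_param_le h1; have /andP[/ltW i2 j2] := inv_param_le h2.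
have rb : `|r1| <= b by exact: residual_le.
have rr : `|r1 - r2| <= `|p1 - p2| * (m + 1) by exact: residual_Lipschitz.
have [n1 _ _] := param_norm (p1 - p2).
(* One factor changes at a time: scalar, adjoint, residual. *)
have -> : p1.2^-1 *: adjoint p1.1.1 r1 - p2.2^-1 *: adjoint p2.1.1 r2 =
    (p1.2^-1 - p2.2^-1) *: adjoint p1.1.1 r1 +
    p2.2^-1 *: adjoint (p1.1.1 - p2.1.1) r1 + p2.2^-1 *: adjoint p2.1.1 (r1 - r2).
  have aB : adjoint p2.1.1 (r1 - r2) = adjoint p2.1.1 r1 - adjoint p2.1.1 r2.
    exact: linearB.
  by rewrite aB adjointB -addrA -scalerDr addrA subrK scalerBl scalerBr addrA subrK.
rewrite (le_trans (ler_normD _ _))// mulrDl; apply: lerD.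
  rewrite (le_trans (ler_normD _ _))// mulrDl; apply: lerD.
    rewrite normrZ -mulrA [_ * `|p1 - p2|]mulrC mulrA ler_pM//.
      exact: inv_param_Lipschitz.
    by rewrite (le_trans (le_adjoint _ _))// ler_pM.
  rewrite normrZ -mulrA ger0_norm// ler_pM// (le_trans (le_adjoint _ _))//.
  by rewrite [b * _]mulrC ler_pM.
rewrite normrZ -mulrA ger0_norm// ler_pM// (le_trans (le_adjoint _ _))//.
by rewrite -mulrA ler_pM// [(m + 1) * _]mulrC.
Qed.

Lemma residual_term_Lipschitz (m : R) : 0 <= m -> exists2 k : R, 0 < k &
  forall p1 p2 x, `|p1 - pbar| < near_radius -> `|p2 - pbar| < near_radius ->
  `|x| <= m -> `|residual_term p1 x - residual_term p2 x| <= k * `|p1 - p2|.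
Proof.
move=> m0; pose a := `|pbar| + 1; pose b := a * (m + 1); pose c := 2 / pbar.2.
have a0 : 0 < a by rewrite ltr_wpDl.
have m1 : 0 < m + 1 by rewrite ltr_wpDl.
have b0 : 0 < b by rewrite mulr_gt0.
have c0 : 0 < c by rewrite divr_gt0.
exists (c ^+ 2 * b ^+ 2 + c * (2 * b * (m + 1))).
  apply: addr_gt0; first by rewrite mulr_gt0 ?exprn_gt0.
  by rewrite mulr_gt0// mulr_gt0// mulr_gt0.
move=> p1 p2 x h1 h2 xm; rewrite /residual_term.
set r1 := p1.1.1 x - _; set r2 := p2.1.1 x - _.
have /andP[/ltW i1 j1] := inv_param_le h1; have /andP[/ltW i2 j2] := inv_param_le h2.
have r1b : `|r1| <= b by rewrite /r1 distrC; exact: residual_le.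
have r2b : `|r2| <= b by rewrite /r2 distrC; exact: residual_le.
have rr : `|r1 - r2| <= `|p1 - p2| * (m + 1).
  have := residual_Lipschitz p1 p2 xm.
  by rewrite -(opprB _ p1.1.2) -(opprB _ p2.1.2) -opprD normrN.
have -> : (2 * p1.2)^-1 * `|r1| ^+ 2 - (2 * p2.2)^-1 * `|r2| ^+ 2 =
   2^-1 * ((p1.2^-1 - p2.2^-1) * `|r1| ^+ 2 +
     p2.2^-1 * ((`|r1| + `|r2|) * (`|r1| - `|r2|))) by rewrite !invfM; ring.
have e1 : `|(p1.2^-1 - p2.2^-1) * `|r1| ^+ 2| <= c ^+ 2 * `|p1 - p2| * b ^+ 2.
  rewrite normrM [X in _ * X]ger0_norm ?exprn_ge0// ler_pM ?exprn_ge0//.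
    exact: inv_param_Lipschitz.
  by rewrite ler_pXn2r ?nnegrE// ltW.
have e2 : `|p2.2^-1 * ((`|r1| + `|r2|) * (`|r1| - `|r2|))| <=
    c * (2 * b * (`|p1 - p2| * (m + 1))).
  rewrite !normrM [X in X * _]ger0_norm// ler_pM ?mulr_ge0// ler_pM//.
    by rewrite ger0_norm ?addr_ge0//; lra.
  exact: le_trans (ler_dist_dist _ _) rr.
rewrite normrM [X in X * _]ger0_norm// (le_trans (ler_wpM2l _ (ler_normD _ _)))//.
have := normr_ge0 ((p1.2^-1 - p2.2^-1) * `|r1| ^+ 2).
have := normr_ge0 (p2.2^-1 * ((`|r1| + `|r2|) * (`|r1| - `|r2|))).
lra.
Qed.

End solution_stability.

(** Used with s = |A1 (x1 - x2)|, d = |x1 - x2| and q = |p1 - p2|. If [s] were larger than the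
    claimed multiple of [q], then q <= s, and substituting the first estimate into the second gives
    s^2 <= (c a + c b) s q, a contradiction. *)
Lemma quadratic_growth_bound (R : realFieldType) (s q d a b c : R) :
  0 <= s -> 0 <= q -> 0 <= a -> 0 <= b -> 0 <= c ->
  d <= a * s + b * q -> s ^+ 2 <= c * (d * q) ->
  d <= (a * (c * a + c * b + 1) + b) * q.
Proof.
move=> s0 q0 a0 b0 c0 hd hs.
suff sq : s <= (c * a + c * b + 1) * q by have := ler_wpM2l a0 sq; lra.
rewrite leNgt; apply/negP => sq.
have ca0 := mulr_ge0 c0 a0; have cb0 := mulr_ge0 c0 b0.
have qs : q <= s by have := mulr_ge0 ca0 q0; have := mulr_ge0 cb0 q0; lra.
have s1 : 0 < s.
  by rewrite (le_lt_trans _ sq)// mulr_ge0// addr_ge0// addr_ge0.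
have h1 : c * (d * q) <= c * ((a * s + b * q) * q) by rewrite ler_wpM2l// ler_wpM2r.
have h2 : c * b * q * q <= c * b * q * s by rewrite ler_wpM2l// mulr_ge0.
have h3 : s * ((c * a + c * b + 1) * q) < s * s by rewrite ltr_pM2l.
have h4 : 0 <= s * q by rewrite mulr_ge0.
clear -hs h1 h2 h3 h4; lra.
Qed.

(** * Lipschitz stability derived from the coercive estimate *)

Section strong_stability.
Context {R : realType} {X Y : euclideanType R}.
Variable g : X -> \bar R.
Hypotheses (g_closed : closed_fun g) (g_proper : proper_fun g)
  (g_convex : convex_fun g).
Variables (pbar : 'Hom(X, Y) * Y * R) (xbar : X).
Hypotheses (mu_gt0 : 0 < pbar.2) (xbar_sol : solution g pbar xbar).
Let m := `|xbar| + 1.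
Hypothesis coercive : exists (r c : R), [/\ 0 < r, 0 < c &
  forall z1 x1 a1 z2 x2 a2,
    fin_subgrad (fenchel_conj g) z1 x1 a1 -> fin_subgrad (fenchel_conj g) z2 x2 a2 ->
    `|x1| <= m -> `|x2| <= m -> `|z1 - dual_point pbar xbar| < r ->
    `|z2 - dual_point pbar xbar| < r ->
    `|x1 - x2| <= c * (`|pbar.1.1 (x1 - x2)| + `|z1 - z2|)].

Lemma solution_local_Lipschitz : exists r0 r l : R,
  [/\ 0 < r0, r0 <= Num.min 1 (pbar.2 / 2), 0 < r, r <= 1 & forall p1 p2 x1 x2,
    `|p1 - pbar| < r0 -> `|p2 - pbar| < r0 -> solution g p1 x1 -> solution g p2 x2 ->
    `|x1 - xbar| <= r -> `|x2 - xbar| <= r -> `|x1 - x2| <= l * `|p1 - p2|].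
Proof.
have [r1 [c [r10 c0 hc]]] := coercive.
have m0 : 0 <= m by rewrite addr_ge0.
have [k k0 hk] := dual_point_Lipschitz mu_gt0 m0.
have [al alE] : exists t, t = `|pbar| + 1 by eexists.
have [cb cbE] : exists t, t = 2 / pbar.2 by eexists.
have al0 : 0 < al by rewrite alE ltr_wpDl.
have cb0 : 0 < cb by rewrite cbE divr_gt0.
have [kx kxE] : exists t, t = cb * (al * al) by eexists.
have kx0 : 0 < kx by rewrite kxE !mulr_gt0.
(* The second bound, with that of [r] below, keeps the dual points within [r1] of the reference one;
   the third absorbs the replacement of [pbar.1.1] by [p1.1.1] in the coercive estimate. *)
pose r0 := Num.min (Num.min 1 (pbar.2 / 2)) (Num.min (r1 / (2 * k)) (2 * c)^-1).
have r00 : 0 < r0.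
  by rewrite /r0 lt_min near_radius_gt0//= lt_min divr_gt0 ?mulr_gt0// invr_gt0 mulr_gt0.
pose r := Num.min 1 (r1 / (2 * kx)).
have rgt0 : 0 < r by rewrite lt_min ltr01 divr_gt0// mulr_gt0.
have rE : r * (2 * kx) <= r1.
  by rewrite -ler_pdivlMr ?mulr_gt0// /r ge_min lexx orbT.
have r0k : r0 * (2 * k) <= r1.
  by rewrite -ler_pdivlMr ?mulr_gt0// /r0 !ge_min lexx !orbT.
have r0c : r0 * (2 * c) <= 1.
  by rewrite -ler_pdivlMr ?mulr_gt0// mul1r /r0 !ge_min lexx !orbT.
have r0n : r0 <= Num.min 1 (pbar.2 / 2) by rewrite /r0 ge_min lexx.
have r1' : r <= 1 by rewrite ge_min lexx.
clearbody r0 r.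
(* The constant of [quadratic_growth_bound] with a = 2 c (1 + cb al), b = 2 c k and c = 2 mu k,
   where mu is [pbar.2]. *)
exists r0, r, (2 * c * (1 + cb * al) * (2 * pbar.2 * k * (2 * c * (1 + cb * al)) +
   2 * pbar.2 * k * (2 * c * k) + 1) + 2 * c * k); split => //.
move=> p1 p2 x1 x2 p1r p2r S1 S2 x1r x2r.
have near p : `|p - pbar| < r0 -> `|p - pbar| < Num.min 1 (pbar.2 / 2).
  by move=> h; exact: lt_le_trans r0n.
have nbar : `|pbar - pbar| < Num.min 1 (pbar.2 / 2).
  by rewrite subrr normr0 near_radius_gt0.
have xm x : `|x - xbar| <= r -> `|x| <= m.
  move=> xr; rewrite -[x](subrK xbar) (le_trans (ler_normD _ _))//.
  by rewrite addrC lerD2l (le_trans xr).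
have AA p x : `|p - pbar| < Num.min 1 (pbar.2 / 2) ->
    `|p.2^-1 *: adjoint p.1.1 (p.1.1 x)| <= cb * (al * `|p.1.1 x|).
  move=> hp; have /andP[/ltW i j] := inv_param_le mu_gt0 hp.
  have [a1 _ _ _] := near_param hp; rewrite -alE in a1; rewrite -cbE in j.
  rewrite normrZ ger0_norm// ler_pM// (le_trans (le_adjoint _ _))//.
  by rewrite ler_wpM2r.
have znear p x : `|p - pbar| < r0 -> `|x - xbar| <= r ->
    `|dual_point p x - dual_point pbar xbar| < r1.
  move=> hp hx; have := hk p pbar x (near _ hp) nbar (xm _ hx) => h1.
  have h2 : `|dual_point pbar x - dual_point pbar xbar| <= kx * `|x - xbar|.
    rewrite dual_pointB normrN (le_trans (AA _ _ nbar))// kxE -!mulrA.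
    rewrite (ler_wpM2l (ltW cb0))// (ler_wpM2l (ltW al0))// (le_trans (le_lfun_norm _ _))//.
    by rewrite ler_wpM2r// alE; have [] := near_param nbar.
  rewrite -[X in X - _](subrK (dual_point pbar x)) -addrA.
  rewrite (le_lt_trans (ler_normD _ _))//.
  have h3 : k * `|p - pbar| < k * r0 by rewrite ltr_pM2l.
  have h4 : kx * `|x - xbar| <= kx * r by rewrite ler_wpM2l// ltW.
  clear -h1 h2 h3 h4 rE r0k; lra.
have p10 : 0 < p1.2.
  by have [_ _ h _] := near_param (near _ p1r); apply: lt_trans h; rewrite divr_gt0.
have p20 : 0 < p2.2.
  by have [_ _ h _] := near_param (near _ p2r); apply: lt_trans h; rewrite divr_gt0.
have [a1 sg1] := (solution_subgrad g_proper g_convex x1 p10).1 S1.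
have [a2 sg2] := (solution_subgrad g_proper g_convex x2 p20).1 S2.
rewrite -/(dual_point p1 x1) in sg1; rewrite -/(dual_point p2 x2) in sg2.
have mono := fin_subgrad_mono sg1 sg2.
have hco := hc _ _ _ _ _ _ (fin_subgrad_conj g_proper sg1) (fin_subgrad_conj g_proper sg2)
  (xm _ x1r) (xm _ x2r) (znear _ _ p1r x1r) (znear _ _ p2r x2r).
pose e := dual_point p1 x2 - dual_point p2 x2.
have eb : `|e| <= k * `|p1 - p2| by apply: hk; [exact: near|exact: near|exact: xm].
set x := x1 - x2 in mono hco *; pose s := `|p1.1.1 x|.
(* The term [e] carries the change of parameter and is of order |p1 - p2|; paired with [x], the
   other term gives s^2 / [p1.2], so monotonicity bounds s^2. *)
have zE : dual_point p1 x1 - dual_point p2 x2 =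
    e - p1.2^-1 *: adjoint p1.1.1 (p1.1.1 x).
  by rewrite -[LHS](subrKA (dual_point p1 x2)) dual_pointB addrC.
rewrite zE in mono hco.
have pos2 : 0 <= 2 * pbar.2 * k by rewrite !mulr_ge0// ltW.
have a0 : 0 <= 2 * c * (1 + cb * al) by rewrite !mulr_ge0 ?addr_ge0 ?mulr_ge0// ltW.
have b0 : 0 <= 2 * c * k by rewrite !mulr_ge0// ltW.
apply: (quadratic_growth_bound (normr_ge0 _ : 0 <= s) (normr_ge0 _) a0 b0 pos2).
- have Ab : `|pbar.1.1 x| <= s + r0 * `|x|.
    have -> : pbar.1.1 x = p1.1.1 x - (p1 - pbar).1.1 x.
      by rewrite /= add_lfunE opp_lfunE opprB addrC subrK.
    rewrite (le_trans (ler_normB _ _))// lerD2l (le_trans (le_lfun_norm _ _))//.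
    rewrite ler_wpM2r// ltW// (le_lt_trans _ p1r)//.
    by have [] := param_norm (p1 - pbar).
  have zb : `|e - p1.2^-1 *: adjoint p1.1.1 (p1.1.1 x)| <= k * `|p1 - p2| + cb * (al * s).
    by rewrite (le_trans (ler_normB _ _))// lerD// AA//; exact: near.
  have h1 : c * (`|pbar.1.1 x| + `|e - p1.2^-1 *: adjoint p1.1.1 (p1.1.1 x)|) <=
      c * (s + r0 * `|x| + (k * `|p1 - p2| + cb * (al * s))).
    by rewrite (ler_wpM2l (ltW c0))// !lerD.
  have h2 : r0 * (2 * c) * `|x| <= 1 * `|x| by rewrite ler_wpM2r.
  have h3 := le_trans hco h1; move: h2 h3; clearbody s.
  move: (`|x|) (`|p1 - p2|) => nx np; lra.
- have [_ _ _ mu2] := near_param (near _ p1r).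
  have sE : inner x (p1.2^-1 *: adjoint p1.1.1 (p1.1.1 x)) = p1.2^-1 * s ^+ 2.
    by rewrite innerZr -adjointE -normr_inner.
  rewrite innerBr sE in mono.
  have ie : inner x e <= `|x| * (k * `|p1 - p2|).
    by rewrite (le_trans (inner_CauchySchwarz _ _))// ler_wpM2l.
  have -> : s ^+ 2 = p1.2 * (p1.2^-1 * s ^+ 2) by rewrite mulrA divff ?gt_eqF// mul1r.
  have h1 : p1.2 * (p1.2^-1 * s ^+ 2) <= p1.2 * (`|x| * (k * `|p1 - p2|)).
    by rewrite (ler_wpM2l (ltW p10))//; lra.
  have h2 : p1.2 * (`|x| * (k * `|p1 - p2|)) <= 2 * pbar.2 * (`|x| * (k * `|p1 - p2|)).
    have kd0 : 0 <= `|x| * (k * `|p1 - p2|) by rewrite !mulr_ge0// ltW.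
    by rewrite (ler_wpM2r kd0)// ltW.
  rewrite (le_trans h1)// (le_trans h2)// le_eqVlt; apply/orP; left; apply/eqP; ring.
Qed.

Lemma solution_stability : exists r0 l : R,
  [/\ 0 < r0, forall p, `|p - pbar| < r0 -> solution g p !=set0 &
    forall p1 p2 x1 x2, `|p1 - pbar| < r0 -> `|p2 - pbar| < r0 ->
      solution g p1 x1 -> solution g p2 x2 -> `|x1 - x2| <= l * `|p1 - p2|].
Proof.
have [r0 [r [l [r00 r0n rgt0 r1 hl]]]] := solution_local_Lipschitz.
have m0 : 0 <= m by rewrite addr_ge0.
have [k k0 hk] := residual_term_Lipschitz mu_gt0 m0.
have nbar : `|pbar - pbar| < Num.min 1 (pbar.2 / 2).
  by rewrite subrr normr0 near_radius_gt0.
have [abar [gxbar hbar]] := (solutionP g_proper pbar xbar).1 xbar_sol.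
have xm x : `|x - xbar| <= r -> `|x| <= m.
  move=> xr; rewrite -[x](subrK xbar) (le_trans (ler_normD _ _))//.
  by rewrite addrC lerD2l (le_trans xr).
(* A point of the sphere no worse than [xbar] would be a second solution at [pbar], which the local
   estimate with p1 = p2 = [pbar] excludes. Compactness makes the gap uniform; if the sphere misses
   [dom g], any [d] serves. *)
have [d d0 hd] : exists2 d : R, 0 < d & forall x b, `|x - xbar| = r ->
    (g x <= b%:E)%E -> residual_term pbar xbar + abar + d <= residual_term pbar x + b.
  have [sph|nsph] := pselect (([set x | `|x - xbar| = r] `&` dom g) !=set0); last first.
    exists 1 => // x b xr gx; exfalso; apply: nsph; exists x; split => //.
    by rewrite /dom /=; apply: le_lt_trans gx (ltry _).
  have [x [a [/= xr gx hx]]] := solution_min g_closed g_proper pbar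
    (@sphere_compact _ _ xbar r) sph.
  exists (residual_term pbar x + a - (residual_term pbar xbar + abar)); last first.
    by move=> y b yr gy; have := hx y b yr gy; lra.
  rewrite subr_gt0 ltNge; apply/negP => le_x.
  have Sx : solution g pbar x.
    apply/(solutionP g_proper); exists a; split => // y b gy.
    by have := hbar y b gy; lra.
  have := hl pbar pbar x xbar; rewrite subrr normr0 mulr0 subrr normr0.
  move=> /(_ r00 r00 Sx xbar_sol); rewrite xr lexx (ltW rgt0) => /(_ isT isT).
  by rewrite leNgt rgt0.
(* The residual changes by less than d / 2 both at [xbar] and on the sphere, so the strict
   inequality survives. *)
pose r2 := Num.min r0 (d / (2 * k)).
have r20 : 0 < r2 by rewrite lt_min r00 divr_gt0// mulr_gt0.
have r2E : r2 * (2 * k) <= d.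
  by rewrite -ler_pdivlMr ?mulr_gt0// /r2 ge_min lexx orbT.
have r2r0 p : `|p - pbar| < r2 -> `|p - pbar| < r0 by rewrite lt_min => /andP[].
have key p : `|p - pbar| < r2 -> (solution g p !=set0) /\
    forall x, solution g p x -> `|x - xbar| < r.
  move=> pr; have pn := lt_le_trans (r2r0 _ pr) r0n.
  have p0 : 0 < p.2.
    by have [_ _ h _] := near_param pn; apply: lt_trans h; rewrite divr_gt0.
  apply: (solution_in_ball g_closed g_proper g_convex p0 rgt0 gxbar).
  move=> x b xr gx.
  have := hk p pbar x pn nbar (xm _ _); rewrite xr lexx => /(_ isT).
  have := hk p pbar xbar pn nbar (xm _ _); rewrite subrr normr0 (ltW rgt0) => /(_ isT).
  rewrite !ler_norml => /andP[_ h1] /andP[h2 _].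
  have h3 := hd x b xr gx; have h4 : k * `|p - pbar| < k * r2 by rewrite ltr_pM2l.
  clear -h1 h2 h3 h4 r2E; lra.
exists r2, l; split => // [p /key[]//|p1 p2 x1 x2 h1 h2 S1 S2].
by apply: hl => //;
  [exact: r2r0|exact: r2r0|apply/ltW/((key _ h1).2)|apply/ltW/((key _ h2).2)].
Qed.

End strong_stability.

(** * Restriction to fewer parameters *)

Section restriction.
Context {R : realType} {P Q : normedModType R}.

Lemma near_contraction (phi : Q -> P) q0 (U : P -> Prop) :
  (forall q q', `|phi q - phi q'| <= `|q - q'|) ->
  (\forall p \near phi q0, U p) -> \forall q \near q0, U (phi q).
Proof.
move=> phi1 /near_normP[d d0 hd]; apply/near_normP; exists d => // q qd.
by apply: hd; exact: le_lt_trans (phi1 _ _) qd.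
Qed.

Lemma single_valued_Lipschitz_around_comp (X : normedModType R) (S : P -> set X)
    (phi : Q -> P) q0 :
  (forall q q', `|phi q - phi q'| <= `|q - q'|) ->
  single_valued_Lipschitz_around S (phi q0) ->
  single_valued_Lipschitz_around (S \o phi) q0.
Proof.
move=> phi1 [U [s [nU US [M [Mr hM]]]]].
exists (phi @^-1` U), (s \o phi); split => [||].
- exact: near_contraction phi1 nU.
- by move=> q /= /US.
(* [M] may be negative; a nonnegative constant allows |phi q - phi q'| to be replaced by the larger
   |q - q'|. *)
- exists (Num.max M 0); split; first by rewrite num_real.
  move=> N; rewrite gt_max => /andP[MN N0] [q q'] /= [Uq Uq'].
  have := hM N MN (phi q, phi q') (conj Uq Uq') => /= /le_trans; apply.
  by rewrite ler_wpM2l// ltW.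
Qed.

Lemma single_valued_LipschitzW (X : normedModType R) (S : P -> set X) p0 :
  single_valued_Lipschitz_around S p0 -> single_valued_around S p0.
Proof.
by move=> [U [s [nU US _]]]; apply: filterS nU => p /US ->; exists (s p).
Qed.

End restriction.

Theorem theorem3p8 (R : realType) (X Y : euclideanType R) (g : X -> \bar R)
    (g_closed : closed_fun g) (g_proper : proper_fun g) (g_convex : convex_fun g)
    (Abar : 'Hom(X, Y)) (bbar : Y) (mubar : R) (mubar_gt0 : 0 < mubar)
    (xbar : X) (xbar_sol : solution g (Abar, bbar, mubar) xbar) :
  let S (A : 'Hom(X, Y)) (b : Y) (mu : R) := solution g (A, b, mu) in
  let zbar : X := mubar^-1 *: adjoint Abar (bbar - Abar xbar) in
  C2_cone_reducible (fenchel_conj g) zbar ->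
  [<->
    (* (i) *)
    [set x | Abar x = 0] `&` par (subdifferential (fenchel_conj g) zbar)
      = [set 0];
    (* (ii) *)
    single_valued_Lipschitz_around
        (fun p : 'Hom(X, Y) * Y * R => S p.1.1 p.1.2 p.2) (Abar, bbar, mubar)
      /\ S Abar bbar mubar = [set xbar];
    (* (iii) *)
    single_valued_Lipschitz_around
        (fun p : Y * R => S Abar p.1 p.2) (bbar, mubar)
      /\ S Abar bbar mubar = [set xbar];
    (* (iv) *)
    single_valued_Lipschitz_around (fun b : Y => S Abar b mubar) bbar
      /\ S Abar bbar mubar = [set xbar];
    (* (v) *)
    single_valued_around
        (fun p : 'Hom(X, Y) * Y * R => S p.1.1 p.1.2 p.2) (Abar, bbar, mubar)
      /\ S Abar bbar mubar = [set xbar];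
    (* (vi) *)
    single_valued_around
        (fun p : Y * R => S Abar p.1 p.2) (bbar, mubar)
      /\ S Abar bbar mubar = [set xbar];
    (* (vii) *)
    single_valued_around (fun b : Y => S Abar b mubar) bbar
      /\ S Abar bbar mubar = [set xbar] ].
Proof.
move=> S zbar [domz red]; pose pbar : 'Hom(X, Y) * Y * R := (Abar, bbar, mubar).
have [a0 sg0] := (solution_subgrad g_proper g_convex (p := pbar) xbar mubar_gt0).1 xbar_sol.
rewrite -[_ *: _]/zbar in sg0.
have pf := fenchel_conj_proper g_proper sg0.
have hx := fin_subgrad_conj g_proper sg0.
set f := fenchel_conj g in hx pf red domz *; set abar := inner zbar xbar - a0 in hx.
rewrite hx.1 /= in red.
have xbarD : subdifferential f zbar xbar by apply/(fin_subgradP _ _ pf); exists abar.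
have i_ii : [set x | Abar x = 0] `&` par (subdifferential f zbar) = [set 0] ->
    single_valued_Lipschitz_around (solution g) pbar /\ solution g pbar = [set xbar].
  move=> hi; have [O [W [C [h [[oO Ov] Ccone C2 [h0 hsurj] OE]]]]] := red.
  have inj u : Abar u = 0 -> par (subdifferential f zbar) u -> u = 0.
    move=> Au pu; have : ([set x | Abar x = 0] `&` par (subdifferential f zbar)) u by [].
    by rewrite hi.
  have xm : `|xbar| <= `|xbar| + 1 by rewrite lerDl.
  have coer := subgrad_coercive (fenchel_conj_convex g_proper) hx.1 oO Ov Ccone C2 h0
    hsurj OE pf hx xm inj.
  have [r0 [l [r00 ex hl]]] := @solution_stability _ _ _ g g_closed g_proper
    g_convex pbar xbar mubar_gt0 xbar_sol coer.
  have uniq p x x' : `|p - pbar| < r0 -> solution g p x -> solution g p x' -> x = x'.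
    move=> pr Sx Sx'; have := hl p p x x' pr pr Sx Sx'.
    by rewrite subrr normr0 mulr0 normr_le0 subr_eq0 => /eqP.
  have set1E p x : `|p - pbar| < r0 -> solution g p x -> solution g p = [set x].
    move=> pr Sx; apply/seteqP; split => [y Sy|_ ->//]; exact: uniq pr Sy Sx.
  split; last by apply: set1E => //; rewrite subrr normr0.
  pose s (p : 'Hom(X, Y) * Y * R) : X := xget 0 (solution g p).
  have sS p : `|p - pbar| < r0 -> solution g p (s p).
    by move=> /ex[x Sx]; rewrite /s; case: xgetP => [y _//|/(_ x)].
  exists [set p | `|p - pbar| < r0], s; split.
  - by apply: (@near_normP R _ pbar (fun p => `|p - pbar| < r0)).2; exists r0.
  - by move=> p /= pr; apply: set1E => //; exact: sS.
  - exists l; split; first exact: num_real.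
    move=> N lN [p p'] /= [pr pr'].
    by rewrite (le_trans (hl _ _ _ _ pr pr' (sS _ pr) (sS _ pr')))// ler_wpM2r// ltW.
have vii_i : single_valued_around (fun b : Y => S Abar b mubar) bbar ->
    [set x | Abar x = 0] `&` par (subdifferential f zbar) = [set 0].
  move=> /near_normP[d d0 hd]; apply/seteqP; split => [u /= [Au pu]|_ ->]; last first.
    split; first by rewrite /= linear0.
    by exists xbar => //; exists [::]; rewrite // mem0v.
  have finD x : subdifferential f zbar x -> fin_subgrad f zbar x abar.
    move=> /(fin_subgradP _ _ pf)[a [fa ha]]; suff -> : abar = a by [].
    by have := hx.1; rewrite fa => -[].
  have Dfin x : fin_subgrad f zbar x abar -> subdifferential f zbar x.
    by move=> hx'; apply/(fin_subgradP _ _ pf); exists abar.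
  have Dc (t : R) x y : 0 <= t -> t <= 1 -> subdifferential f zbar x ->
      subdifferential f zbar y -> subdifferential f zbar (t *: x + (1 - t) *: y).
    by move=> t0 t1 /finD Dx /finD Dy; apply: Dfin; exact: fin_subgrad_convex.
  have [x0 [e [e0 D1 D2]]] := par_segment Dc pu.
  have n1 : 0 < `|Abar (x0 - xbar)| + 1 by rewrite ltr_wpDl.
  (* Keeps [b] within [d] of [bbar], where the solution is unique. *)
  pose t := Num.min 1 (d / (2 * (`|Abar (x0 - xbar)| + 1))).
  have t0 : 0 < t by rewrite lt_min ltr01 divr_gt0// mulr_gt0.
  have t1 : t <= 1 by rewrite ge_min lexx.
  have tE : t * (2 * (`|Abar (x0 - xbar)| + 1)) <= d.
    by rewrite -ler_pdivlMr ?mulr_gt0// /t ge_min lexx orbT.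
  pose b := bbar + t *: Abar (x0 - xbar).
  have [|x Sx] := hd b.
    rewrite /b addrAC subrr add0r normrZ gtr0_norm//.
    by have := mulr_ge0 (ltW t0) (normr_ge0 (Abar (x0 - xbar))); lra.
  (* The shift of [b] cancels the change of [Abar w]: the residual, hence the dual point [zbar], is
     unchanged. As [w] is still a subgradient of [f] at [zbar], Fenchel duality makes it a
     solution. *)
  have sol v : Abar v = 0 -> subdifferential f zbar (x0 + v) ->
      S Abar b mubar (t *: (x0 + v) + (1 - t) *: xbar).
    move=> Av Dv; have Dw := Dc _ _ _ (ltW t0) t1 Dv xbarD.
    set w := _ + _ in Dw *.
    have [a ha] := subgrad_conj_inv g_closed g_proper g_convex domz Dw.
    apply/(solution_subgrad g_proper g_convex (p := (Abar, b, mubar)) _ mubar_gt0).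
    exists a; rewrite /=; suff -> : b - Abar w = bbar - Abar xbar by [].
    have -> : w = xbar + t *: (x0 - xbar) + t *: v.
      by rewrite /w convex_combE -[RHS]addrA -[in RHS]scalerDr [in RHS]addrAC.
    have aD x1 x2 : Abar (x1 + x2) = Abar x1 + Abar x2 by exact: linearD.
    have aZ c x1 : Abar (c *: x1) = c *: Abar x1 by exact: linearZ.
    rewrite (aD (xbar + _)) (aZ _ v) Av scaler0 addr0 (aD xbar) aZ /b opprD addrACA.
    by rewrite subrr addr0.
  have Ae : Abar (e *: u) = 0 by rewrite linearZ /= Au scaler0.
  have S1 := sol _ Ae D1.
  have S2 : S Abar b mubar (t *: (x0 - e *: u) + (1 - t) *: xbar).
    by apply: sol => //; rewrite linearN /= Ae oppr0.
  (* The two ends of the shrunken segment coincide, so 2 t e u = 0. *)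
  rewrite Sx in S1 S2; have := etrans S1 (esym S2) => /addIr/eqP.
  rewrite -subr_eq0 -scalerBr scaler_eq0 gt_eqF//= opprD opprK addrACA subrr add0r.
  rewrite -mulr2n -scaler_nat !scaler_eq0 pnatr_eq0/= gt_eqF//=.
  by move=> /eqP.
pose phi (q : Y * R) : 'Hom(X, Y) * Y * R := (Abar, q.1, q.2).
have phi1 q q' : `|phi q - phi q'| <= `|q - q'|.
  by rewrite !prod_normE /= subrr normr0 [Num.max 0 _]max_r.
pose psi (b : Y) : Y * R := (b, mubar).
have psi1 b b' : `|psi b - psi b'| <= `|b - b'|.
  by rewrite prod_normE /= subrr normr0 max_l.
pose T (q : Y * R) := S Abar q.1 q.2.
have ii_iii : single_valued_Lipschitz_around (solution g) pbar ->
    single_valued_Lipschitz_around T (bbar, mubar).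
  exact: (@single_valued_Lipschitz_around_comp _ _ _ _ (solution g) phi (bbar, mubar) phi1).
have iii_iv : single_valued_Lipschitz_around T (bbar, mubar) ->
    single_valued_Lipschitz_around (fun b : Y => S Abar b mubar) bbar.
  exact: (@single_valued_Lipschitz_around_comp _ _ _ _ T psi bbar psi1).
have v_vi : single_valued_around (solution g) pbar ->
    single_valued_around T (bbar, mubar).
  exact: (@near_contraction _ _ _ phi (bbar, mubar)
    (fun p => exists x, solution g p = [set x]) phi1).
have vi_vii : single_valued_around T (bbar, mubar) ->
    single_valued_around (fun b : Y => S Abar b mubar) bbar.
  exact: (@near_contraction _ _ _ psi bbar (fun q => exists x, T q = [set x]) psi1).
tfae.
- by move=> /i_ii.
- by move=> [/ii_iii hT hS]; split.
- by move=> [/iii_iv hT hS]; split.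
(* From (iv) to (v) the set of parameters grows, so no restriction applies: the passage goes through
   (vii), (i) and (ii). *)
- by move=> [/single_valued_LipschitzW/vii_i/i_ii[/single_valued_LipschitzW]].
- by move=> [/v_vi hT hS]; split.
- by move=> [/vi_vii hT hS]; split.
- by move=> [/vii_i].
Qed.
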